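(* Let $\mathcal B$ be a finite set of complex numbers $\beta$ with $\mathrm{Re}(\beta)\ge\gamma\ge1$ for all $\beta\in\mathcal B$, let $s>0$, and for $\beta\in\mathcal B$ let $\theta_\beta(z)=(z+\beta)^{-1}$. Let $H$ be a bounded, mildly regular open subset of $\mathbb C=\mathbb R^2$ such that $H\supset G_\gamma:=\{z\in\mathbb C:|z-1/(2\gamma)|<1/(2\gamma)\}$ and $\mathrm{Re}(z)>0$ for all $z\in H$. For a positive integer $m$, define $\Lambda_s:C^m(\bar H)\to C^m(\bar H)$ by $$(\Lambda_sf)(z)=\sum_{\beta\in\mathcal B}\Big|\frac{d}{dz}\theta_\beta(z)\Big|^sf(\theta_\beta(z))=\sum_{\beta\in\mathcal B}|z+\beta|^{-2s}f(\theta_\beta(z)).$$ Then $\Lambda_s$ has a unique (up to normalization) positive eigenvector $v_s\in C^m(\bar H)$, $v_s$ is $C^\infty$, and writing $z=(x,y)$, for all $(x,y)\in\bar H$: $$-\frac{2s}{\gamma}\le\frac{\partial_xv_s}{v_s}\le0,\qquad -\frac{s}{4\gamma^2(s+1)}\le\frac{\partial_x^2v_s}{v_s}\le\frac{2s(2s+1)}{\gamma^2},$$ $$-\frac{2s(2s+1)(2s+2)}{\gamma^3}\le\frac{\partial_x^3v_s}{v_s}\le\frac{(2s)(2s+2)}{\gamma^3(s+2)^2},\qquad -\frac{2s(2s+2)(3s+3)}{\gamma^4}\le\frac{\partial_x^4v_s}{v_s}\le\frac{(2s)(2s+1)(2s+2)(2s+3)}{\gamma^4},$$ $$\frac{|\partial_yv_s|}{v_s}\le\frac{s}{\gamma},\qquad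 -\frac{2s}{\gamma^2}\le\frac{\partial_y^2v_s}{v_s}\le\frac{2s(2s+1)}{4\gamma^2},$$ $$\frac{|\partial_y^3v_s|}{v_s}\le\frac{(2s)(2s+2)}{\gamma^3}\max\{25\sqrt5/72,(2s+1)/8\},\qquad -\frac{2s(2s+2)(3s+3)}{\gamma^4}\le\frac{\partial_y^4v_s}{v_s}\le\frac{(2s)(2s+1)(2s+2)(2s+3)}{\gamma^4}.$$ Hence, with $D_1=\partial/\partial x$, $D_2=\partial/\partial y$, for $k=1,2$ and $1\le j\le4$, $$\frac{|D_k^jv_s(x,y)|}{v_s(x,y)}\le\frac{(2s)(2s+1)\cdots(2s+j-1)}{\gamma^j}.$$
   Context: $H$ is mildly regular if there exist $\eta>0$, $M\ge1$ such that whenever $x,y\in H$ with $\|x-y\|<\eta$ there is a Lipschitz $\psi:[0,1]\to H$ with $\psi(0)=x$, $\psi(1)=y$, $\int_0^1\|\psi'(t)\|dt\le M\|x-y\|$. $C^m(\bar H)$ is the Banach space of real $C^m$ functions on $H$ all of whose partial derivatives of order $\le m$ extend continuously to $\bar H$. A positive eigenvector means an eigenvector $v_s$ with $v_s(z)>0$ for all $z\in\bar H$. *)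

(* Defs.v *)
(* The plane C = R^2 is modelled as R * R,
   a point z = x + i y being the pair (x, y). *)
From HB Require Import structures.
From mathcomp Require Import all_boot all_order all_algebra.
From mathcomp Require Import all_classical all_reals all_analysis.
Set Implicit Arguments. Unset Strict Implicit. Unset Printing Implicit Defensive.
Import Order.TTheory GRing.Theory Num.Theory.
Import numFieldNormedType.Exports.
Local Open Scope classical_set_scope.
Local Open Scope ring_scope.

Section Defs.
Variable R : realType.
Local Notation P := (R * R)%type.

Definition enorm (z : P) : R := Num.sqrt (z.1 ^+ 2 + z.2 ^+ 2).

Definition cinv (z : P) : P :=
  (z.1 / (z.1 ^+ 2 + z.2 ^+ 2), - z.2 / (z.1 ^+ 2 + z.2 ^+ 2)).

Definition theta (b z : P) : P := cinv (z + b).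

Definition Lambda (s : R) (B : seq P) (f : P -> R) (z : P) : R :=
  \sum_(b <- B) (enorm (z + b)) `^ (- (2 * s)) * f (theta b z).

Definition dir (k : bool) : P := if k then (1, 0) else (0, 1).
Definition pd (k : bool) (f : P -> R) : P -> R := fun z => derive f z (dir k).
Definition Dw (w : seq bool) (f : P -> R) : P -> R := foldr pd f w.

Definition cext (H : set P) (g f : P -> R) : Prop :=
  {within closure H, continuous g} /\ forall z, H z -> g z = f z.

Definition Cm_bar (m : nat) (H : set P) (f : P -> R) : Prop :=
  (forall w : seq bool, (size w < m)%N ->
     forall z, H z -> forall k, derivable (Dw w f) z (dir k)) /\
  (forall w : seq bool, (size w <= m)%N -> exists g, cext H g (Dw w f)).

Definition positive_on_closure (H : set P) (f : P -> R) : Prop :=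
  forall g, cext H g f -> forall z, closure H z -> 0 < g z.

Definition ratio_between (H : set P) (f : P -> R) (w : seq bool) (lo hi : R)
  : Prop :=
  forall g0 gw, cext H g0 f -> cext H gw (Dw w f) ->
    forall z, closure H z -> lo <= gw z / g0 z <= hi.

Definition absratio_le (H : set P) (f : P -> R) (w : seq bool) (c : R)
  : Prop :=
  forall g0 gw, cext H g0 f -> cext H gw (Dw w f) ->
    forall z, closure H z -> `|gw z| / g0 z <= c.

Definition lipschitz_path (psi : R -> P) : Prop :=
  exists L : R, forall t1 t2, 0 <= t1 <= 1 -> 0 <= t2 <= 1 ->
    enorm (psi t1 - psi t2) <= L * `|t1 - t2|.

(* mild regularity, with psi' the (a.e. defined) derivative of psi *)
Definition mildly_regular (H : set P) : Prop :=
  exists (eta M : R), 0 < eta /\ 1 <= M /\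
    forall x y, H x -> H y -> enorm (x - y) < eta ->
      exists psi : R -> P,
        lipschitz_path psi /\
        (forall t, 0 <= t <= 1 -> H (psi t)) /\
        psi 0 = x /\ psi 1 = y /\
        (\int[@lebesgue_measure R]_(t in `[0%R, 1%R]) (enorm (derive1 psi t))%:E
           <= (M * enorm (x - y))%:E)%E.

Definition Ggamma (gamma : R) : set P :=
  [set z | enorm (z - ((2 * gamma)^-1, 0)) < (2 * gamma)^-1].

End Defs.

(* Main.v *)
(* Lambda maps the kernel z |-> |z + beta|^(-2s) to a positive combination of
   kernels with poles b + 1/beta, and {Re >= gamma} is stable under
   beta |-> b + 1/beta.  The adjoint of Lambda therefore acts on functions of
   the pole; a Harnack inequality shows that its iterates grow like rho^n up to
   bounded factors, so an ultralimit of the Cesaro means of rho^(-n) times the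
   n-th iterate is a positive functional mu on functions of the pole, invariant
   up to the factor rho.  Then v(z) = mu(beta |-> |z + beta|^(-2s)) satisfies
   Lambda v = rho v.  Derivatives pass through mu because the second order
   Taylor remainder of the kernel is bounded by the kernel itself; so v is
   smooth, and a bound on D^w v / v follows from the same bound for one kernel,
   where it is a polynomial inequality in p = x/r^2 and q = y/r^2 on the disc
   gamma (p^2 + q^2) <= p.
   For uniqueness, take the minimum and the maximum of the quotient of two
   positive eigenfunctions on the compact closure of H.  The eigenvalues agree,
   the quotient stays equal to its extremum along the orbit of an extremal point
   under any theta_b, and all these orbits converge to the fixed point of
   theta_b; hence the minimum equals the maximum. *)
Require Import Defs.
From HB Require Import structures.
From mathcomp Require Import all_boot all_order all_algebra.
From mathcomp Require Import all_classical all_reals all_analysis.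
From mathcomp Require Import ring lra.
Import Order.TTheory GRing.Theory Num.Theory.
Import numFieldNormedType.Exports.
Set Implicit Arguments.
Unset Strict Implicit.
Local Open Scope classical_set_scope.
Local Open Scope ring_scope.

(** * The kernel and the dual operator *)

Section Modulus.
Variable R : realType.
Implicit Types (z w b : R * R) (c : R).

Lemma enorm_ge0 z : 0 <= enorm z.
Proof. exact: sqrtr_ge0. Qed.

Lemma enorm_sq z : enorm z ^+ 2 = z.1 ^+ 2 + z.2 ^+ 2.
Proof. by rewrite sqr_sqrtr// addr_ge0// sqr_ge0. Qed.

Lemma ler_enorm z c : 0 <= c -> z.1 ^+ 2 + z.2 ^+ 2 <= c ^+ 2 -> enorm z <= c.
Proof.
move=> c0 h; rewrite -(@ler_pXn2r _ 2) ?nnegrE ?enorm_ge0//.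
by rewrite enorm_sq.
Qed.

Lemma Re_le_enorm z : z.1 <= enorm z.
Proof. have := enorm_ge0 z; have := enorm_sq z; nra. Qed.

Lemma enorm_gt0 z : 0 < z.1 -> 0 < enorm z.
Proof. by move=> h; apply: (lt_le_trans h); exact: Re_le_enorm. Qed.

Lemma sqnorm_gt0 z : 0 < z.1 -> 0 < z.1 ^+ 2 + z.2 ^+ 2.
Proof. by move=> h; nra. Qed.

Lemma enormN z : enorm (- z) = enorm z.
Proof. by rewrite /enorm /= !sqrrN. Qed.

Lemma ler_enormD z w : enorm (z + w) <= enorm z + enorm w.
Proof.
apply: ler_enorm; first by rewrite addr_ge0 ?enorm_ge0.
rewrite [leRHS]sqrrD !enorm_sq /=.
suff : z.1 * w.1 + z.2 * w.2 <= enorm z * enorm w by nra.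
apply: le_trans (ler_norm _) _.
rewrite -(@ler_pXn2r _ 2) ?nnegrE ?mulr_ge0 ?enorm_ge0//.
rewrite real_normK ?num_real// exprMn !enorm_sq.
have := sqr_ge0 (z.1 * w.2 - z.2 * w.1); nra.
Qed.

Lemma enorm_cinv z : 0 < z.1 -> enorm (cinv z) * enorm z = 1.
Proof.
move=> z0; apply/eqP; rewrite -(@eqrXn2 _ 2) ?mulr_ge0 ?enorm_ge0//.
apply/eqP; rewrite exprMn !enorm_sq /cinv /=.
have := sqnorm_gt0 z0; move=> h.
by field; rewrite gt_eqF.
Qed.

Lemma cinv_Re_gt0 z : 0 < z.1 -> 0 < (cinv z).1.
Proof. by move=> z0; rewrite divr_gt0// sqnorm_gt0. Qed.

(** Both sides are |zw + 1|, because z (w + 1/z) = zw + 1 = w (1/w + z). *)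
Lemma enorm_add_cinv z w : 0 < z.1 -> 0 < w.1 ->
  enorm z * enorm (w + cinv z) = enorm w * enorm (cinv w + z).
Proof.
move=> z0 w0; apply/eqP; rewrite -(@eqrXn2 _ 2) ?mulr_ge0 ?enorm_ge0//.
apply/eqP; rewrite !exprMn !enorm_sq /=.
have := sqnorm_gt0 z0; have := sqnorm_gt0 w0; move=> ? ?.
by field; rewrite !gt_eqF.
Qed.

End Modulus.

(** * The kernel |z|^(-2s) *)

Section Kernel.
Variables (R : realType) (s : R).
Implicit Types (z w b : R * R) (c : R).

Definition ker z : R := enorm z `^ (- (2 * s)).

Lemma ker_gt0 z : 0 < z.1 -> 0 < ker z.
Proof. by move=> z0; rewrite powR_gt0// enorm_gt0. Qed.

Lemma ker_ge0 z : 0 <= ker z.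
Proof. exact: powR_ge0. Qed.

Lemma ker_add_cinv z w : 0 < z.1 -> 0 < w.1 ->
  ker z * ker (w + cinv z) = ker w * ker (cinv w + z).
Proof.
by move=> z0 w0; rewrite -!powRM ?enorm_ge0// enorm_add_cinv.
Qed.

Hypothesis s0 : 0 < s.

(** The exponent -2s is negative, so a comparison of moduli reverses for the kernels. *)
Lemma ler_ker z w c : 0 < z.1 -> 0 < w.1 -> 0 <= c ->
  enorm z <= c * enorm w -> ker w <= c `^ (2 * s) * ker z.
Proof.
move=> z0 w0 c0 h; rewrite /ker !powRN.
rewrite ler_pdivlMr ?powR_gt0 ?enorm_gt0// ler_pdivrMl ?powR_gt0 ?enorm_gt0//.
rewrite mulrC -powRM ?enorm_ge0//.
have s2 : 0 <= 2 * s by rewrite mulr_ge0// ltW.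
rewrite [c * _]mulrC in h.
by rewrite [s * 2]mulrC ge0_ler_powR// ?nnegrE ?mulr_ge0 ?enorm_ge0.
Qed.

Lemma ker_le1 z : 1 <= z.1 -> ker z <= 1.
Proof.
move=> z1; rewrite /ker powRN invf_le1 ?powR_gt0 ?enorm_gt0//; last lra.
have e1 : 1 <= enorm z by apply: (le_trans z1); exact: Re_le_enorm.
by rewrite -[leLHS](powRr0 (enorm z)) ler_powR// mulr_ge0// ltW.
Qed.

End Kernel.

(** * The dual operator and its Harnack inequality *)

Section DualOperator.
Variables (R : realType) (s gamma : R) (B : seq (R * R)).
Implicit Types (z w b beta : R * R) (phi psi : R * R -> R).
Local Notation ker := (ker s).
Hypotheses (s0 : 0 < s) (gamma1 : 1 <= gamma).
Hypothesis Bgamma : forall b, b \in B -> gamma <= b.1.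

(* The formal adjoint of [Lambda]: it acts on functions of the pole [beta] of
   the kernels [z |-> |z + beta|^(-2s)], and [Lambda] applied to such a kernel
   is the dual operator applied to it as a function of [beta]. *)
Definition dualop phi beta : R := \sum_(b <- B) ker beta * phi (b + cinv beta).

Lemma add_cinv_Re b beta : gamma <= b.1 -> gamma <= beta.1 ->
  gamma <= (b + cinv beta).1.
Proof.
move=> hb hbeta; have : 0 < beta.1 by have := gamma1; lra.
by move=> /cinv_Re_gt0; rewrite /cinv /=; lra.
Qed.

(** The duality: the right side is [Lambda] applied to the kernel with pole [beta]. Term by term it
    is [ker_add_cinv] for [beta] and [z + b]. *)
Lemma dualop_ker z beta : gamma <= beta.1 -> - gamma < z.1 ->
  dualop (fun beta => ker (z + beta)) beta =
  \sum_(b <- B) ker (z + b) * ker (theta b z + beta).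
Proof.
move=> hbeta hz; rewrite /dualop !big_seq; apply: eq_bigr => b bB.
rewrite addrA ker_add_cinv//; first by have := gamma1; lra.
have := Bgamma bB; rewrite /=; lra.
Qed.

(** The weights are nonnegative and the half-plane of poles is stable, so only values there
    matter. *)
Lemma iter_dualop_le n phi psi :
  (forall beta, gamma <= beta.1 -> phi beta <= psi beta) ->
  forall beta, gamma <= beta.1 -> iter n dualop phi beta <= iter n dualop psi beta.
Proof.
move=> h; elim: n => [|n IH] //= beta hb.
rewrite /dualop !big_seq ler_sum// => b bB.
by rewrite ler_wpM2l ?ker_ge0// IH// add_cinv_Re// Bgamma.
Qed.

Lemma iter_dualop_eq n phi psi :
  (forall beta, gamma <= beta.1 -> phi beta = psi beta) ->
  forall beta, gamma <= beta.1 -> iter n dualop phi beta = iter n dualop psi beta.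
Proof.
move=> h beta hb; apply/eqP; rewrite eq_le !iter_dualop_le// => ? ?.
  by rewrite h.
by rewrite h.
Qed.

Lemma iter_dualop_lin n c phi psi :
  iter n dualop (fun beta => c * phi beta + psi beta) =
  fun beta => c * iter n dualop phi beta + iter n dualop psi beta.
Proof.
elim: n => [|n IH] //=; rewrite IH; apply/funext => beta.
rewrite /dualop mulr_sumr -big_split /=; apply: eq_bigr => b _.
by rewrite mulrDr mulrCA.
Qed.

Lemma iter_dualop0 n : iter n dualop (fun=> 0) = fun=> 0.
Proof.
elim: n => [|n IH] //=; rewrite IH; apply/funext => beta.
by rewrite /dualop big1// => b _; rewrite mulr0.
Qed.

Lemma iter_dualopZ n c phi :
  iter n dualop (fun beta => c * phi beta) =
  fun beta => c * iter n dualop phi beta.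
Proof.
transitivity (iter n dualop (fun beta => c * phi beta + (fun=> 0) beta)).
  by congr (iter _ _ _); apply/funext => beta; rewrite addr0.
by rewrite iter_dualop_lin iter_dualop0; apply/funext => beta; rewrite addr0.
Qed.

Lemma iter_dualop_sum n (r : seq (R * R)) (c : R * R -> R)
    (f : R * R -> R * R -> R) :
  iter n dualop (fun beta => \sum_(b <- r) c b * f b beta) =
  fun beta => \sum_(b <- r) c b * iter n dualop (f b) beta.
Proof.
elim: r => [|b r IH].
  rewrite [X in iter _ _ X](_ : _ = fun=> 0) ?iter_dualop0.
    by apply/funext => beta; rewrite big_nil.
  by apply/funext => beta; rewrite big_nil.
transitivity (iter n dualop
    (fun beta => c b * f b beta + \sum_(b <- r) c b * f b beta)).
  by congr (iter _ _ _); apply/funext => beta; rewrite big_cons.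
by rewrite iter_dualop_lin IH; apply/funext => beta; rewrite big_cons.
Qed.

(** Both [beta] and [z + beta] have modulus at least 1 and they differ by at most 1 in modulus, so
    each modulus is at most twice the other. *)
Lemma ker_add_comparable z beta : 1 <= beta.1 -> 0 <= z.1 -> enorm z <= 1 ->
  ker (z + beta) <= 2 `^ (2 * s) * ker beta /\
  ker beta <= 2 `^ (2 * s) * ker (z + beta).
Proof.
move=> hb z0 z1.
have hzb : 1 <= (z + beta).1 by rewrite /=; lra.
have e1 := le_trans hzb (Re_le_enorm _).
have e2 := le_trans hb (Re_le_enorm _).
have t1 := ler_enormD z beta.
have t2 : enorm beta <= enorm (z + beta) + enorm z.
  by rewrite -(enormN z) -[X in enorm X <= _](addKr z) addrC ler_enormD.
split; apply: ler_ker => //; lra.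
Qed.

(** One factor 2^(2s) for each of the two poles that are compared. *)
Definition harnack : R := 2 `^ (2 * s) * 2 `^ (2 * s).

(* The kernels |z + beta|^(-2s) with |z| <= 1 and Re z >= 0 are uniformly
   comparable, and the cone they span is stable under the dual operator. *)
Lemma iter_dualop_harnack n z beta beta' :
  gamma <= beta.1 -> gamma <= beta'.1 -> 0 <= z.1 -> enorm z <= 1 ->
  iter n dualop (fun beta => ker (z + beta)) beta * ker beta' <=
  harnack * ker beta * iter n dualop (fun beta => ker (z + beta)) beta'.
Proof.
move=> hb hb'; elim: n z => [|n IH] z z0 z1.
  have [h _] := ker_add_comparable (le_trans gamma1 hb) z0 z1.
  have [_ h'] := ker_add_comparable (le_trans gamma1 hb') z0 z1.
  apply: le_trans (ler_pM (ker_ge0 _ _) (ker_ge0 _ _) h h') _.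
  by rewrite /harnack /= le_eqVlt; apply/orP; left; apply/eqP; ring.
(* The innermost [dualop] turns the kernel at z into a combination, with weights independent of the
   pole, of kernels at the points [theta b z]. These again have Re >= 0 and modulus at most 1, so
   the induction hypothesis applies to each. *)
rewrite !iterSr.
have eqM be : gamma <= be.1 ->
    iter n dualop (dualop (fun beta => ker (z + beta))) be =
    \sum_(b <- B) ker (z + b) * iter n dualop (fun beta => ker (theta b z + beta)) be.
  move=> hbe; have /(congr1 (@^~ be)) /= <- := iter_dualop_sum n B
    (fun b => ker (z + b)) (fun b beta => ker (theta b z + beta)).
  apply: iter_dualop_eq => // be' hbe'.
  by rewrite dualop_ker//; have := gamma1; lra.
rewrite !eqM// mulr_suml mulr_sumr !big_seq ler_sum// => b bB.
rewrite -mulrA [leRHS]mulrCA ler_wpM2l ?ker_ge0// IH//.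
- by apply/ltW/cinv_Re_gt0 => /=; have := Bgamma bB; have := gamma1; lra.
- have hzb : 1 <= (z + b).1.
    by have := Bgamma bB; have := gamma1; rewrite /=; lra.
  have e1 := le_trans hzb (Re_le_enorm _).
  have hzb0 : 0 < (z + b).1 by lra.
  have := enorm_cinv hzb0; rewrite -/(theta b z).
  have := enorm_ge0 (cinv (z + b)); nra.
Qed.

End DualOperator.
(** * The invariant functional *)

Section GrowthRate.
Variable R : realType.

Lemma powR_root (x : R) (n : nat) : (0 < n)%N -> 0 <= x ->
  (x `^ (n%:R^-1)) ^+ n = x.
Proof.
move=> n0 x0; rewrite -powR_mulrn ?powR_ge0// -powRrM mulVf ?pnatr_eq0 -?lt0n//.
by rewrite powRr1.
Qed.

(** The rate rho is the supremum of the roots (a n / C)^(1/n) over n >= 1. *)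
Lemma growth_rate (a : nat -> R) (C : R) : 0 < C -> (forall n, 0 < a n) ->
  (forall n m, a (n + m)%N <= C * (a n * a m)) ->
  (forall n m, a n * a m <= C * a (n + m)%N) ->
  exists2 rho, 0 < rho & forall n, rho ^+ n <= C * a n /\ a n <= C * rho ^+ n.
Proof.
move=> C0 a0 aD_le aD_ge.
have CX_le n m : (a n / C) ^+ m.+1 <= a (m.+1 * n)%N / C.
  elim: m => [|m IH]; first by rewrite expr1 mul1n.
  rewrite exprS; apply: le_trans (ler_wpM2l _ IH) _; first exact/ltW/divr_gt0.
  rewrite mulf_div ler_pdivrMr ?mulr_gt0// (_ : a (m.+2 * n)%N / C * (C * C) =
    C * a (m.+2 * n)%N) ?(mulSn m.+1) ?aD_ge//.
  by field; rewrite gt_eqF.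
have CX_ge n m : C * a (m.+1 * n)%N <= (C * a n) ^+ m.+1.
  elim: m => [|m IH]; first by rewrite expr1 mul1n.
  rewrite exprS; apply: le_trans (ler_wpM2l _ IH); last exact/ltW/mulr_gt0.
  rewrite -mulrA ler_pM2l// mulrCA mulSn; exact: aD_le.
(* Fekete: a is sub- and supermultiplicative up to the factor C, so every
   (a n / C)^(1/n) is at most every (C * a m)^(1/m). *)
pose S := [set t : R | 0 <= t /\ exists n, t ^+ n.+1 <= a n.+1 / C].
have ubS m t : S t -> t <= (C * a m.+1) `^ (m.+1%:R^-1).
  move=> [t0 [n tn]].
  rewrite -(@ler_pXn2r _ m.+1) ?nnegrE ?powR_ge0// powR_root//; last first.
    exact/ltW/mulr_gt0.
  rewrite -(@ler_pXn2r _ n.+1) ?nnegrE ?exprn_ge0//; last exact/ltW/mulr_gt0.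
  rewrite -exprM mulnC exprM.
  apply: le_trans (CX_ge _ _).
  apply: (@le_trans _ _ ((a n.+1 / C) ^+ m.+1)).
    by rewrite lerXn2r ?nnegrE ?exprn_ge0//; apply/ltW/divr_gt0.
  apply: le_trans (CX_le _ _) _; rewrite mulnC.
  set u := a _; have u0 : 0 < u by exact: a0.
  (* At n = m = 0 the two hypotheses give a 0 <= C and 1 <= C * a 0, hence 1 <= C^2. *)
  have C1 : 1 <= C.
    have h1 := aD_le 0%N 0%N; have h2 := aD_ge 0%N 0%N; rewrite addn0 in h1 h2.
    have h3 := a0 0%N.
    have h4 : a 0%N <= C by rewrite -(ler_pM2r h3).
    have h5 : 1 <= C * a 0%N by rewrite -(ler_pM2r h3) mul1r -mulrA.
    nra.
  rewrite ler_pdivrMr// mulrAC -expr2.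
  by rewrite ler_peMl ?(ltW u0)// expr_ge1 ?(ltW C0).
have Sroot m : S ((a m.+1 / C) `^ (m.+1%:R^-1)).
  split; first exact: powR_ge0.
  by exists m; rewrite powR_root// ltW// divr_gt0.
have supS : has_sup S.
  by split; [exists ((a 1%N / C) `^ (1%:R^-1)); exact: Sroot|
             exists ((C * a 1%N) `^ (1%:R^-1)) => t; exact: ubS].
have rho0 : 0 < sup S.
  apply: lt_le_trans (ub_le_sup supS.2 (Sroot 0%N)).
  by rewrite powR_gt0// divr_gt0.
exists (sup S) => // -[|m].
  rewrite expr0 mulr1; have := a0 0%N.
  have := aD_le 0%N 0%N; have := aD_ge 0%N 0%N; rewrite addn0 => h1 h2 h0.
  split; last by rewrite -(ler_pM2r h0).
  by rewrite -(ler_pM2r h0) mul1r -mulrA.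
split.
  rewrite -[leRHS](@powR_root _ m.+1)//; last exact/ltW/mulr_gt0.
  rewrite lerXn2r ?nnegrE ?powR_ge0 ?(ltW rho0)//.
  by apply: ge_sup; [exact: supS.1|move=> t; exact: ubS].
rewrite mulrC -ler_pdivrMr// -[leLHS](@powR_root _ m.+1)//; last exact/ltW/divr_gt0.
rewrite lerXn2r ?nnegrE ?powR_ge0 ?(ltW rho0)//.
by have := ub_le_sup supS.2 (Sroot m).
Qed.

End GrowthRate.

(** * Limits along ultrafilters *)

Section UltraLimit.
Variable R : realType.
Implicit Type u : nat -> R.

Lemma ultra_fmap {T U : Type} (f : T -> U) (F : set_system T) :
  UltraFilter F -> UltraFilter (f @ F).
Proof.
move=> FU; split; first exact: fmap_proper_filter.
move=> G GF sFG; rewrite predeqE => A; split; last exact: sFG.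
move=> GA; have [//|FnA] := in_ultra_setVsetC (f @^-1` A) FU.
have : G (A `&` ~` A) by apply: filterI => //; exact: sFG.
by rewrite setICr => /filter_not_empty.
Qed.

(** The image ultrafilter lives on the compact segment [-C, C], where every ultrafilter
    converges. *)
Lemma bounded_ultra_cvg (F : set_system nat) u (C : R) : UltraFilter F ->
  (forall n, `|u n| <= C) -> cvg (u @ F).
Proof.
move=> FU uC; have := @segment_compact R (- C) C; rewrite compact_ultra.
move=> /(_ (u @ F) (ultra_fmap u FU)) [|p [_ up]]; last by apply/cvg_ex; exists p.
rewrite /fmap /=; apply: filterE => n /=; rewrite in_itv/= -ler_norml; exact: uC.
Qed.

End UltraLimit.

(** * Construction of the invariant functional *)

Section DualEigenfunctional.
Variables (R : realType) (s gamma : R) (B : seq (R * R)).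
Implicit Types (beta : R * R) (phi psi : R * R -> R).
Local Notation ker := (ker s).
Local Notation dualop := (dualop s B).
Hypotheses (s0 : 0 < s) (gamma1 : 1 <= gamma) (B0 : B != [::]).
Hypothesis Bgamma : forall b, b \in B -> gamma <= b.1.

(** The domain of the functional. Values at poles outside the half-plane are left free. *)
Definition kdom phi :=
  exists C, forall beta, gamma <= beta.1 -> `|phi beta| <= C * ker beta.

Lemma kdom_lin c phi psi : kdom phi -> kdom psi ->
  kdom (fun beta => c * phi beta + psi beta).
Proof.
move=> [C1 h1] [C2 h2]; exists (`|c| * C1 + C2) => beta hb.
rewrite mulrDl; apply: le_trans (ler_normD _ _) (lerD _ (h2 _ hb)).
by rewrite normrM -mulrA ler_wpM2l// h1.
Qed.

(** The kernel is at most 1 at [b + cinv beta], so [phi] is bounded there, and the weight [ker beta]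
    in [dualop] supplies the domination. *)
Lemma kdom_dualop phi : kdom phi -> kdom (dualop phi).
Proof.
move=> [C h]; exists (\sum_(b <- B) `|C|) => beta hb.
apply: le_trans (ler_norm_sum _ _ _) _.
rewrite mulr_suml !big_seq ler_sum// => b bB.
have hbb := add_cinv_Re gamma1 (Bgamma bB) hb.
rewrite normrM (ger0_norm (ker_ge0 _ _)) mulrC ler_wpM2r ?ker_ge0//.
apply: le_trans (h _ hbb) _; apply: le_trans (ler_norm _) _; rewrite normrM.
rewrite ler_piMr// ger0_norm ?ker_ge0// ker_le1//.
exact: le_trans gamma1 hbb.
Qed.

Lemma iter_dualop_ker_gt0 n beta : gamma <= beta.1 -> 0 < iter n dualop ker beta.
Proof.
elim: n beta => [|n IH] beta hb /=; first by rewrite ker_gt0//; have := gamma1; lra.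
have [b [bB hB]] : exists b, b \in B /\ true.
  by case: (B) B0 => // b B' _; exists b; rewrite mem_head.
have pos b' : b' \in B -> 0 < ker beta * iter n dualop ker (b' + cinv beta).
  move=> b'B; apply: mulr_gt0; first by rewrite ker_gt0//; have := gamma1; lra.
  by rewrite IH//; exact: (add_cinv_Re gamma1 (Bgamma b'B) hb).
rewrite /dualop big_seq (big_rem b)//= bB.
rewrite ltr_pwDl ?pos//= sumr_ge0// => b' b'B.
by rewrite ltW// pos.
Qed.

(** A reference pole at which all iterates are evaluated; the Harnack inequality compares it with
    the others. *)
Let beta0 : R * R := (gamma, 0).

(** By Harnack at z = 0, the m-th iterate of the kernel is, up to a factor, the multiple [a m] of
    the kernel at every pole. Applying n further steps makes [a] multiplicative up to that
    factor. *)
Lemma iter_dualop_growth : exists rho K, [/\ 0 < rho, 0 < K &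
  forall n, rho ^+ n <= K * iter n dualop ker beta0 /\
            iter n dualop ker beta0 <= K * rho ^+ n].
Proof.
have hb0 : gamma <= beta0.1 by [].
have k0 : 0 < ker beta0 by rewrite ker_gt0//=; have := gamma1; lra.
have kerE : ker = (fun beta => ker (0 + beta)).
  by apply/funext => beta; rewrite add0r.
have e0 : enorm (0 : R * R) <= 1 by rewrite /enorm /= expr0n /= addr0 sqrtr0.
have C0 : 0 < harnack s by rewrite mulr_gt0 ?powR_gt0.
pose a n := iter n dualop ker beta0 / ker beta0.
have a0 n : 0 < a n by rewrite divr_gt0// iter_dualop_ker_gt0.
have H beta beta' n : gamma <= beta.1 -> gamma <= beta'.1 ->
    iter n dualop ker beta * ker beta' <=
    harnack s * ker beta * iter n dualop ker beta'.
  move=> hb hb'; have := iter_dualop_harnack s0 gamma1 Bgamma n hb hb' _ e0.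
  by rewrite -kerE; apply.
have [n m|n m|rho rho0 h] := growth_rate C0 a0.
- have -> : harnack s * (a n * a m) =
      harnack s * a m * iter n dualop ker beta0 / ker beta0 by rewrite /a; ring.
  rewrite {1}/a iterD ler_pM2r ?invr_gt0//.
  rewrite -(congr1 (@^~ beta0) (iter_dualopZ s B n (harnack s * a m) ker)).
  apply: (iter_dualop_le s gamma1 Bgamma) => // beta hb.
  have -> : harnack s * a m * ker beta =
    harnack s * ker beta * iter m dualop ker beta0 / ker beta0 by rewrite /a; ring.
  by rewrite ler_pdivlMr// H.
- have -> : a n * a m = a m * iter n dualop ker beta0 / ker beta0.
    by rewrite /a; ring.
  rewrite {2}/a iterD mulrA ler_pM2r ?invr_gt0//.
  rewrite -(congr1 (@^~ beta0) (iter_dualopZ s B n (a m) ker)).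
  rewrite -(congr1 (@^~ beta0)
    (iter_dualopZ s B n (harnack s) (iter m dualop ker))).
  apply: (iter_dualop_le s gamma1 Bgamma) => // beta hb.
  rewrite /a mulrAC ler_pdivrMr//.
  by apply: le_trans (H _ _ _ hb0 hb) _; rewrite mulrAC.
(* The first summand serves the lower bound on the iterates, the second the upper bound. *)
exists rho, (harnack s / ker beta0 + harnack s * ker beta0); split => //.
  by rewrite addr_gt0 ?mulr_gt0 ?invr_gt0.
move=> n; have [h1 h2] := h n; have i0 := iter_dualop_ker_gt0 n hb0.
have r0 : 0 < rho ^+ n by exact: exprn_gt0.
split; rewrite mulrDl.
  apply: le_trans h1 _; rewrite /a mulrA mulrAC lerDl.
  by rewrite !mulr_ge0 ?ltW.
have : iter n dualop ker beta0 <= harnack s * ker beta0 * rho ^+ n.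
  by rewrite mulrAC -ler_pdivrMr.
by move=> h3; apply: le_trans h3 _; rewrite lerDr !mulr_ge0 ?ltW// invr_gt0.
Qed.

(** Linearity and monotonicity pass from the Cesaro means to their ultralimit, invariance comes from
    telescoping, and positivity on the kernel from the lower growth bound. *)
Lemma dual_eigenfunctional : exists rho (mu : (R * R -> R) -> R),
  [/\ 0 < rho,
      forall c phi psi, kdom phi -> kdom psi ->
        mu (fun beta => c * phi beta + psi beta) = c * mu phi + mu psi,
      forall phi psi, kdom phi -> kdom psi ->
        (forall beta, gamma <= beta.1 -> phi beta <= psi beta) -> mu phi <= mu psi,
      forall phi, kdom phi -> mu (dualop phi) = rho * mu phi &
      0 < mu ker].
Proof.
have hb0 : gamma <= beta0.1 by [].
have [rho [K [rho0 K0 growth]]] := iter_dualop_growth.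
pose avg phi N :=
  N.+1%:R^-1 * \sum_(n < N.+1) rho ^- n * iter n dualop phi beta0.
(* Iteration preserves -C ker <= phi <= C ker, and the upper growth bound compensates rho^(-n). *)
have iter_bound phi C n : (forall beta, gamma <= beta.1 -> `|phi beta| <= C * ker beta) ->
    `|rho ^- n * iter n dualop phi beta0| <= C * K.
  move=> hC; rewrite normrM gtr0_norm ?invr_gt0 ?exprn_gt0//.
  have C0 : 0 <= C.
    have := le_trans (normr_ge0 _) (hC _ hb0).
    by rewrite pmulr_lge0// ker_gt0//=; have := gamma1; lra.
  rewrite ler_pdivrMl ?exprn_gt0//.
  apply: (@le_trans _ _ (C * iter n dualop ker beta0)); last first.
    by rewrite mulrCA ler_wpM2l// mulrC; exact: (growth n).2.
  rewrite ler_norml -mulNr.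
  rewrite -(congr1 (@^~ beta0) (iter_dualopZ s B n C ker)).
  rewrite -(congr1 (@^~ beta0) (iter_dualopZ s B n (- C) ker)).
  apply/andP; split; apply: (iter_dualop_le s gamma1 Bgamma) => // beta hb.
    by have := hC _ hb; rewrite ler_norml mulNr => /andP[].
  by have := hC _ hb; rewrite ler_norml => /andP[].
have avg_bound phi : kdom phi -> exists C, forall N, `|avg phi N| <= C.
  move=> [C hC]; exists (C * K) => N.
  rewrite /avg normrM gtr0_norm ?invr_gt0// ler_pdivrMl//.
  apply: le_trans (ler_norm_sum _ _ _) _.
  apply: (@le_trans _ _ (\sum_(n < N.+1) (C * K))).
    by apply: ler_sum => n _; exact: iter_bound.
  by rewrite sumr_const card_ord -[leLHS]mulr_natl.
(* Along an ultrafilter every bounded sequence converges, so the means have a limit for all of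
   [kdom] at once. *)
have [F [FU ooF]] := ultraFilterLemma eventually_filter.
have avg_cvg phi : kdom phi -> cvg (avg phi @ F).
  by move=> /avg_bound[C hC]; exact: bounded_ultra_cvg FU hC.
exists rho, (fun phi => lim (avg phi @ F)); split => //.
- move=> c phi psi hphi hpsi.
  have -> : avg (fun beta => c * phi beta + psi beta) =
      (fun N => c * avg phi N + avg psi N).
    apply/funext => N; rewrite /avg mulrCA -mulrDr; congr (_ * _).
    rewrite mulr_sumr -big_split /=; apply: eq_bigr => n _.
    by rewrite iter_dualop_lin; ring.
  by apply/cvg_lim => //; apply: cvgD; [apply: cvgMl_tmp|]; exact: avg_cvg.
- move=> phi psi hphi hpsi le; apply: ler_lim; [exact: avg_cvg|exact: avg_cvg|].
  apply: filterE => N; rewrite ler_pM2l ?invr_gt0// ler_sum// => n _.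
  rewrite ler_pM2l ?invr_gt0 ?exprn_gt0//.
  exact: (iter_dualop_le s gamma1 Bgamma).
- move=> phi hphi.
  (* Shifting the sum by one index changes only its two end terms. These are bounded, so division by
     N + 1 makes the error vanish. *)
  pose err N := N.+1%:R^-1 *
    (rho * (rho ^- N.+1 * iter N.+1 dualop phi beta0) - rho * phi beta0).
  have -> : avg (dualop phi) = (fun N => rho * avg phi N + err N).
    apply/funext => N; rewrite /avg /err mulrCA -mulrDr; congr (_ * _).
    have -> : \sum_(n < N.+1) rho ^- n * iter n dualop (dualop phi) beta0 =
        rho * \sum_(n < N.+1) rho ^- n.+1 * iter n.+1 dualop phi beta0.
      rewrite mulr_sumr; apply: eq_bigr => n _; rewrite iterSr exprS invfM.
      by rewrite !mulrA mulfV ?gt_eqF// mul1r.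
    pose f n := rho ^- n * iter n dualop phi beta0.
    have tele : \sum_(n < N.+1) f n.+1 - \sum_(n < N.+1) f n = f N.+1 - f 0%N.
      rewrite -(big_mkord xpredT f) -(big_mkord xpredT (fun n => f n.+1)).
      by rewrite -sumrB telescope_sumr.
    have f0E : f 0%N = phi beta0 by rewrite /f expr0 invr1 mul1r.
    rewrite -f0E -mulrBr -mulrDr -[rho ^- N.+1 * _]/(f N.+1) -tele.
    by rewrite addrC subrK.
  have err0 : err @ F --> (0 : R).
    have [C hC] := hphi.
    apply: cvg_trans (_ : err @ \oo --> 0); first exact: (cvg_app _ ooF).
    apply/norm_cvg0P.
    apply: (@squeeze_cvgr _ _ _ _ (fun=> 0)
      (fun N => (rho * (C * K) + `|rho * phi beta0|) * harmonic N)).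
    + apply: filterE => N; rewrite normr_ge0 /= normrM gtr0_norm ?invr_gt0//.
      rewrite mulrC ler_wpM2r ?invr_ge0//.
      apply: le_trans (ler_normB _ _) _; rewrite lerD2r normrM gtr0_norm//.
      by rewrite ler_pM2l// iter_bound.
    + exact: cvg_cst.
    + rewrite -[X in _ --> X](mulr0 (rho * (C * K) + `|rho * phi beta0|)).
      by apply: cvgMl_tmp; exact: cvg_harmonic.
  apply/cvg_lim => //; rewrite -[X in _ --> X]addr0; apply: cvgD => //.
  by apply: cvgMl_tmp; exact: avg_cvg.
- apply: (@lt_le_trans _ _ (K^-1)); first by rewrite invr_gt0.
  apply: limr_ge.
    by apply: avg_cvg; exists 1 => beta _; rewrite mul1r ger0_norm ?ker_ge0.
  apply: filterE => N; rewrite /avg ler_pdivlMl//.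
  rewrite mulr_natl -[X in _ *+ X](card_ord N.+1) -sumr_const ler_sum// => n _.
  by rewrite ler_pdivlMl ?exprn_gt0// mulrC ler_pdivrMl// (growth n).1.
Qed.

End DualEigenfunctional.
(** * Derivatives of the kernel and of its transform *)

Section MeanValue.
Variable R : realType.
Implicit Types (g dg ddg : R -> R) (h t C : R).

Lemma mean_value_abs g dg (h : R) :
  (forall t, `|t| <= `|h| -> is_derive t 1 g (dg t)) ->
  exists2 c, `|c| <= `|h| & g h - g 0 = dg c * h.
Proof.
move=> Dg.
have cont a b : (forall t, a <= t <= b -> `|t| <= `|h|) ->
    {within `[a, b], continuous g}.
  move=> hab; apply: derivable_within_continuous => t.
  by rewrite in_itv/= => /hab /Dg [].
case: (leP 0 h) => h0.
  have sub t : 0 <= t <= h -> `|t| <= `|h|.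
    by move=> /andP[t0 th]; rewrite !ger0_norm.
  have [||c] := @MVT_segment R g dg 0 h h0.
  - by move=> t; rewrite in_itv/= => /andP[? ?]; apply: Dg; apply: sub; rewrite !ltW.
  - exact: cont.
  by rewrite in_itv/= subr0 => /sub ch eq; exists c.
have sub t : h <= t <= 0 -> `|t| <= `|h|.
  by move=> /andP[ht t0]; rewrite !ler0_norm ?lerN2// ltW.
have [||c] := @MVT_segment R g dg h 0 (ltW h0).
- by move=> t; rewrite in_itv/= => /andP[? ?]; apply: Dg; apply: sub; rewrite !ltW.
- exact: cont.
rewrite in_itv/= => /sub ch eq; exists c => //.
by rewrite -opprB eq; ring.
Qed.

(** Two applications of the mean value theorem, which cost only the factor 1/2 of the usual
    remainder. *)
Lemma taylor2_abs g dg ddg (h C : R) :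
  (forall t, `|t| <= `|h| -> is_derive t 1 g (dg t)) ->
  (forall t, `|t| <= `|h| -> is_derive t 1 dg (ddg t)) ->
  (forall t, `|t| <= `|h| -> `|ddg t| <= C) ->
  `|g h - g 0 - h * dg 0| <= C * h ^+ 2.
Proof.
move=> Dg Ddg ddgC.
have [c ch ->] := mean_value_abs Dg.
have [|d dc eq] := @mean_value_abs dg ddg c.
  by move=> t tc; apply: Ddg; exact: le_trans tc ch.
have b : `|ddg d| * `|c| <= C * `|h|.
  by rewrite ler_pM// ddgC//; exact: le_trans dc ch.
rewrite mulrC -mulrBr eq !normrM -[h ^+ 2]real_normK ?num_real// expr2.
by rewrite [leRHS]mulrA mulrC ler_wpM2r.
Qed.

End MeanValue.

(* The derivatives of |z|^(-2s) are polynomials in p = x/|z|^2 and q = y/|z|^2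
   times |z|^(-2s), since D_x p = q^2 - p^2, D_y p = D_x q = -2pq and
   D_y q = p^2 - q^2. *)
Inductive pqpoly (R : Type) : Type :=
| PQconst of R
| PQp
| PQq
| PQadd of pqpoly R & pqpoly R
| PQmul of pqpoly R & pqpoly R.
Arguments PQp {R}.
Arguments PQq {R}.

(** * Symbolic derivatives of the kernel *)

Section KernelDerivatives.
Variables (R : realType) (s : R).
Implicit Types (e : pqpoly R) (z v : R * R) (p q : R).

Fixpoint pqeval e p q : R :=
  match e with
  | PQconst c => c
  | PQp => p
  | PQq => q
  | PQadd e1 e2 => pqeval e1 p q + pqeval e2 p q
  | PQmul e1 e2 => pqeval e1 p q * pqeval e2 p q
  end.

Fixpoint pqderiv v e : pqpoly R :=
  match e with
  | PQconst _ => PQconst 0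
  | PQp => PQadd (PQmul (PQconst v.1) (PQadd (PQmul PQq PQq)
             (PQmul (PQconst (-1)) (PQmul PQp PQp))))
             (PQmul (PQconst (-2 * v.2)) (PQmul PQp PQq))
  | PQq => PQadd (PQmul (PQconst (-2 * v.1)) (PQmul PQp PQq))
             (PQmul (PQconst v.2) (PQadd (PQmul PQp PQp)
             (PQmul (PQconst (-1)) (PQmul PQq PQq))))
  | PQadd e1 e2 => PQadd (pqderiv v e1) (pqderiv v e2)
  | PQmul e1 e2 => PQadd (PQmul e1 (pqderiv v e2)) (PQmul (pqderiv v e1) e2)
  end.

(** The factor multiplying [e] is the logarithmic derivative of |z|^(-2s) along v, which is -2s (v_1
    p + v_2 q). *)
Definition pqstep v e : pqpoly R :=
  PQadd (pqderiv v e)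
    (PQmul (PQadd (PQmul (PQconst (-2 * s * v.1)) PQp)
                  (PQmul (PQconst (-2 * s * v.2)) PQq)) e).

Definition sqn z : R := z.1 ^+ 2 + z.2 ^+ 2.

Definition kerpq e z : R := pqeval e (z.1 / sqn z) (z.2 / sqn z) * ker s z.

Lemma kerE z : ker s z = sqn z `^ (- s).
Proof.
rewrite /ker /enorm -powR12_sqrt ?addr_ge0 ?sqr_ge0// -powRrM.
by congr (_ `^ _); field.
Qed.

Section Line.
Variables (X Y : R -> R) (dx dy t : R).
Hypotheses (DX : is_derive t 1 X dx) (DY : is_derive t 1 Y dy).
Hypothesis X0 : 0 < X t.
Local Notation N := (fun u => sqn (X u, Y u)).

Let N0 : 0 < N t.
Proof. exact: (@sqnorm_gt0 _ (X t, Y t)). Qed.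

Lemma is_derive_sqn : is_derive t 1 N (2 * (X t * dx + Y t * dy)).
Proof.
apply: (is_derive_eq (is_deriveD (is_deriveM DX DX) (is_deriveM DY DY))).
by rewrite /GRing.scale /=; ring.
Qed.

Let DNV : is_derive t 1 (fun u => (N u)^-1) (- (N t) ^- 2 * (2 * (X t * dx + Y t * dy))).
Proof. by apply: (is_deriveV _ is_derive_sqn); rewrite gt_eqF. Qed.

Lemma is_derive_pq e :
  is_derive t 1 (fun u => pqeval e (X u / N u) (Y u / N u))
    (pqeval (pqderiv (dx, dy) e) (X t / N t) (Y t / N t)).
Proof.
have Nn0 : X t ^+ 2 + Y t ^+ 2 != 0 by rewrite gt_eqF.
elim: e => [c|||e1 D1 e2 D2|e1 D1 e2 D2] /=.
- exact: is_derive_cst.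
- apply: (is_derive_eq (is_deriveM DX DNV)).
  by rewrite /GRing.scale /= /sqn /=; field.
- apply: (is_derive_eq (is_deriveM DY DNV)).
  by rewrite /GRing.scale /= /sqn /=; field.
- exact: is_deriveD.
- apply: (is_derive_eq (is_deriveM D1 D2)).
  by rewrite /GRing.scale /=; ring.
Qed.

Lemma is_derive_kerpq_curve e :
  is_derive t 1 (fun u => kerpq e (X u, Y u))
    (kerpq (pqstep (dx, dy) e) (X t, Y t)).
Proof.
have Nn0 : X t ^+ 2 + Y t ^+ 2 != 0 by rewrite gt_eqF.
have Dk : is_derive t 1 (fun u => ker s (X u, Y u))
    ((-2 * s * dx * (X t / N t) + -2 * s * dy * (Y t / N t)) * ker s (X t, Y t)).
  have -> : (fun u => ker s (X u, Y u)) = (@powR R ^~ (- s)) \o N.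
    by apply/funext => u /=; rewrite kerE.
  have := @is_derive1_comp R _ N t _ _ (is_derive1_powR (- s) N0) is_derive_sqn.
  move=> D; apply: (is_derive_eq D).
  rewrite powRD; last by rewrite (gt_eqF N0) implybT.
  rewrite powR_inv1 ?(ltW N0)// -kerE /sqn /=.
  by field.
apply: (is_derive_eq (is_deriveM (is_derive_pq e) Dk)).
rewrite /kerpq /= /GRing.scale /=; ring.
Qed.

End Line.

Lemma is_derive_kerpq e v z t : 0 < (z + t *: v).1 ->
  is_derive t 1 (fun u => kerpq e (z + u *: v)) (kerpq (pqstep v e) (z + t *: v)).
Proof.
move=> h0.
have D (a b : R) : is_derive t 1 (fun u => a + u *: b) b.
  apply: (is_derive_eq (is_deriveD (is_derive_cst a t 1)
    (is_deriveM (is_derive_id t 1) (is_derive_cst b t 1)))).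
  by rewrite /GRing.scale /=; ring.
have := @is_derive_kerpq_curve _ _ _ _ t (D z.1 v.1) (D z.2 v.2) h0 e.
by rewrite -surjective_pairing.
Qed.

Lemma pqeval_bound e (M : R) : 0 <= M -> exists2 C, 0 <= C &
  forall p q, `|p| <= M -> `|q| <= M -> `|pqeval e p q| <= C.
Proof.
move=> M0; elim: e => [c|||e1 [C1 C10 h1] e2 [C2 C20 h2]|e1 [C1 C10 h1] e2 [C2 C20 h2]] /=.
- by exists `|c|.
- by exists M.
- by exists M.
- exists (C1 + C2); first by rewrite addr_ge0.
  by move=> p q hp hq; apply: le_trans (ler_normD _ _) _; rewrite lerD ?h1 ?h2.
- exists (C1 * C2); first by rewrite mulr_ge0.
  by move=> p q hp hq; rewrite normrM ler_pM ?h1 ?h2.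
Qed.

(** For Re z >= 1/4 both |p| and |q| are at most 1/|z| <= 4, so a fixed polynomial in them is
    bounded. *)
Lemma kerpq_bound e : exists2 C, 0 <= C &
  forall z, 1 / 4 <= z.1 -> `|kerpq e z| <= C * ker s z.
Proof.
have [C C0 h] := pqeval_bound e (ltac:(lra) : 0 <= 4 :> R).
exists C => // z z4; rewrite normrM (ger0_norm (ker_ge0 _ _)).
have n0 : 0 < sqn z by apply: sqnorm_gt0; lra.
rewrite ler_wpM2r ?ker_ge0// h// normrM normfV (gtr0_norm n0) ler_pdivrMr//.
  by rewrite /sqn ger0_norm; nra.
have x2 : 1 / 16 <= z.1 ^+ 2 by nra.
have := sqr_ge0 (2 * `|z.2| - 1 / 2); rewrite /sqn -[z.2 ^+ 2]real_normK ?num_real//.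
have := normr_ge0 z.2; nra.
Qed.

Hypothesis s0 : 0 < s.

(** The shift has length at most 1/4, so |z + tv| >= 1/4 and |z| <= |z + tv| + 1/4 <= 2 |z + tv|. *)
Lemma ker_shift z v t : 1 / 2 <= z.1 -> enorm v <= 1 -> `|t| <= 1 / 4 ->
  ker s (z + t *: v) <= 2 `^ (2 * s) * ker s z /\ 1 / 4 <= (z + t *: v).1.
Proof.
move=> hz hv ht.
have etv : enorm (t *: v) <= 1 / 4.
  have -> : enorm (t *: v) = `|t| * enorm v.
    rewrite /enorm /= /GRing.scale /= !exprMn -mulrDr sqrtrM ?sqr_ge0//.
    by rewrite sqrtr_sqr.
  have := enorm_ge0 v; have := normr_ge0 t; nra.
have tv1 : - (1 / 4) <= (t *: v).1.
  have := Re_le_enorm (- (t *: v)); rewrite enormN /=; lra.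
have r4 : 1 / 4 <= (z + t *: v).1 by move: tv1; rewrite /=; lra.
split=> //; apply: ler_ker => //; [lra|lra|].
have := Re_le_enorm (z + t *: v).
have := ler_enormD (z + t *: v) (- (t *: v)); rewrite addrK enormN; lra.
Qed.

(** The second derivative along the segment is again a polynomial in p and q times the kernel, hence
    at most a constant times the kernel at z. A bound relative to the kernel can be fed to a
    positive functional. *)
Lemma kerpq_taylor e v : enorm v <= 1 -> exists2 C, 0 <= C & forall z h,
  1 / 2 <= z.1 -> `|h| <= 1 / 4 ->
  `|kerpq e (z + h *: v) - kerpq e z - h * kerpq (pqstep v e) z| <=
  C * h ^+ 2 * ker s z.
Proof.
move=> hv; have [C C0 hC] := kerpq_bound (pqstep v (pqstep v e)).
exists (C * 2 `^ (2 * s)); first by rewrite mulr_ge0 ?powR_ge0.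
move=> z h hz hh.
have sh t : `|t| <= `|h| ->
    ker s (z + t *: v) <= 2 `^ (2 * s) * ker s z /\ 1 / 4 <= (z + t *: v).1.
  by move=> th; apply: ker_shift => //; exact: le_trans th hh.
have pos t : `|t| <= `|h| -> 0 < (z + t *: v).1 by move=> /sh[_]; lra.
rewrite mulrAC.
have := @taylor2_abs R (fun t => kerpq e (z + t *: v))
  (fun t => kerpq (pqstep v e) (z + t *: v))
  (fun t => kerpq (pqstep v (pqstep v e)) (z + t *: v)) h
  (C * 2 `^ (2 * s) * ker s z).
rewrite scale0r addr0; apply.
- by move=> t /pos; exact: is_derive_kerpq.
- by move=> t /pos; exact: is_derive_kerpq.
- move=> t /sh[h1 h2]; apply: le_trans (hC _ h2) _.
  by rewrite -mulrA ler_wpM2l.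
Qed.

End KernelDerivatives.

(** * Directional derivatives from quadratic remainders *)

Section QuadraticRemainder.
Variable R : realType.

Lemma near_fst (z : R * R) (P : R -> Prop) :
  (\forall t \near z.1, P t) -> \forall w \near z, P w.1.
Proof. exact: (@cvg_fst _ _ (nbhs z.1) (nbhs z.2)). Qed.

Lemma near_snd (z : R * R) (P : R -> Prop) :
  (\forall t \near z.2, P t) -> \forall w \near z, P w.2.
Proof. exact: (@cvg_snd _ _ (nbhs z.1) (nbhs z.2)). Qed.

Lemma near_dist_le (x d : R) : 0 < d -> \forall t \near x, `|x - t| <= d.
Proof. by move=> d0; apply: filterS (nbhsx_ballx x d d0) => t; exact: ltW. Qed.

Lemma quadratic_is_derive (f : R * R -> R) (z v : R * R) (l C : R) :
  (forall h, `|h| <= 1 / 4 -> `|f (z + h *: v) - f z - h * l| <= C * h ^+ 2) ->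
  is_derive z v f l.
Proof.
move=> hC.
have cvgf : h^-1 *: (f (h *: v + z) - f z) @[h --> (0 : R)^'] --> l.
  apply/cvgrPdist_le => /= eps eps0; near=> h.
  have h0 : h != 0 by near: h; exact: nbhs_dnbhs_neq.
  have h4 : `|h| <= 1 / 4 by near: h; apply: dnbhs0_le; lra.
  have hCe : `|h| <= eps / (`|C| + 1).
    by near: h; apply: dnbhs0_le; rewrite divr_gt0// ltr_wpDl.
  have -> : l - h^-1 *: (f (h *: v + z) - f z) =
      - h^-1 * (f (z + h *: v) - f z - h * l).
    by rewrite [h *: v + z]addrC /GRing.scale /=; field.
  rewrite normrM normrN normfV ler_pdivrMl ?normr_gt0//.
  apply: le_trans (hC _ h4) _.
  rewrite -[h ^+ 2]real_normK ?num_real// expr2 mulrCA ler_wpM2l//.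
  rewrite ler_pdivlMr ?ltr_wpDl// in hCe.
  have := ler_norm C; have := normr_ge0 h; nra.
apply: DeriveDef; last exact: cvg_lim cvgf.
by apply/cvg_ex; exists l.
Unshelve. all: by end_near. Qed.

End QuadraticRemainder.

(** * The transform of the kernel by a positive linear functional *)

Section KernelTransform.
Variables (R : realType) (s gamma : R) (mu : (R * R -> R) -> R).
Implicit Types (z beta : R * R) (phi psi : R * R -> R) (e : pqpoly R).
Hypotheses (s0 : 0 < s) (gamma1 : 1 <= gamma).
Hypothesis mu_lin : forall c phi psi, kdom s gamma phi -> kdom s gamma psi ->
  mu (fun beta => c * phi beta + psi beta) = c * mu phi + mu psi.
Hypothesis mu_le : forall phi psi, kdom s gamma phi -> kdom s gamma psi ->
  (forall beta, gamma <= beta.1 -> phi beta <= psi beta) -> mu phi <= mu psi.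
Hypothesis mu_ker : 0 < mu (ker s).

Lemma kdom0 : kdom s gamma (fun=> 0).
Proof. by exists 0 => beta _; rewrite normr0 mul0r. Qed.

Lemma mu0 : mu (fun=> 0) = 0.
Proof.
have := mu_lin 1 kdom0 kdom0.
rewrite [X in mu X](_ : _ = fun=> 0); last by apply/funext => ?; rewrite mul1r addr0.
by rewrite mul1r => /(congr1 (fun x => x - mu (fun=> 0))); rewrite subrr addrK.
Qed.

Lemma kdomZ c phi : kdom s gamma phi -> kdom s gamma (fun beta => c * phi beta).
Proof.
move=> h; have := kdom_lin c h kdom0; congr (kdom _ _ _).
by apply/funext => ?; rewrite addr0.
Qed.

Lemma muZ c phi : kdom s gamma phi -> mu (fun beta => c * phi beta) = c * mu phi.
Proof.
move=> h; have := mu_lin c h kdom0; rewrite mu0 addr0 => <-.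
by congr mu; apply/funext => ?; rewrite addr0.
Qed.

Lemma mu_abs phi psi : kdom s gamma phi -> kdom s gamma psi ->
  (forall beta, gamma <= beta.1 -> `|phi beta| <= psi beta) -> `|mu phi| <= mu psi.
Proof.
move=> hphi hpsi h; rewrite ler_norml; apply/andP; split.
  rewrite lerNl -mulN1r -(muZ (-1) hphi).
  apply: mu_le => //; first exact: kdomZ.
  by move=> beta /h; rewrite ler_norml mulN1r lerNl => /andP[].
by apply: mu_le => // beta /h; rewrite ler_norml => /andP[].
Qed.

(** A class of functions of z that is closed under differentiation and contains [kmean]. *)
Definition ktrans e z : R := mu (fun beta => kerpq s e (z + beta)).

(** The eigenfunction, once [mu] is the invariant functional. *)
Definition kmean z : R := mu (fun beta => ker s (z + beta)).

(** Here Re(z + beta) >= 1/4, so |beta| <= (1 + 4 |z|) |z + beta|. The thresholds left of the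
    imaginary axis, here and below, make all points with Re z >= 0 interior. *)
Lemma kdom_ker z : - (3 / 4) <= z.1 -> kdom s gamma (fun beta => ker s (z + beta)).
Proof.
move=> hz; exists ((1 + 4 * enorm z) `^ (2 * s)) => beta hb.
rewrite ger0_norm ?ker_ge0//; have e0 := enorm_ge0 z.
have := gamma1 => g1.
have hzb : 1 / 4 <= (z + beta).1 by move: hz hb; rewrite /=; lra.
apply: ler_ker => //; [lra|lra|lra|].
have := Re_le_enorm (z + beta); have := ler_enormD (z + beta) (- z).
rewrite enormN [z + beta - z]addrAC subrr add0r; nra.
Qed.

Lemma kdom_kerpq e z : - (3 / 4) <= z.1 ->
  kdom s gamma (fun beta => kerpq s e (z + beta)).
Proof.
move=> hz; have [C C0 hC] := kerpq_bound s e; have [C' hC'] := kdom_ker hz.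
exists (C * C') => beta hb.
have := gamma1 => g1.
apply: le_trans (hC _ _) _; first by move: hz hb; rewrite /=; lra.
by rewrite -mulrA ler_wpM2l//; apply: le_trans (ler_norm _) (hC' _ hb).
Qed.

(** As |z + beta| <= (1 + |z|) |beta|, the kernel at z + beta dominates a positive multiple of the
    kernel at beta, on which [mu] is positive. *)
Lemma kmean_gt0 z : - (1 / 2) <= z.1 -> 0 < kmean z.
Proof.
move=> hz; have := gamma1 => g1.
have c0 : 0 < (1 + enorm z) `^ (2 * s).
  by rewrite powR_gt0// ltr_pwDl// enorm_ge0.
rewrite -(pmulr_rgt0 _ c0); apply: (lt_le_trans mu_ker).
have dz : kdom s gamma (fun beta => ker s (z + beta)) by apply: kdom_ker; lra.
rewrite -muZ//; apply: mu_le; [|exact: kdomZ|].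
  by exists 1 => beta _; rewrite mul1r ger0_norm ?ker_ge0.
move=> beta hb; have e0 := enorm_ge0 z.
apply: ler_ker => //; [by move: hz hb; rewrite /=; lra|lra|lra|].
have := Re_le_enorm beta; have := ler_enormD z beta; nra.
Qed.

Lemma enorm_dir k : enorm (dir R k) <= 1.
Proof. by case: k; apply: ler_enorm => //=; rewrite !expr2; lra. Qed.

(** The estimate for a single kernel is an inequality between functions of the pole with constants
    independent of it, so it survives [mu]. *)
Lemma ktrans_taylor e k : exists2 C, 0 <= C & forall z h,
  - (1 / 2) <= z.1 -> `|h| <= 1 / 4 ->
  `|ktrans e (z + h *: dir R k) - ktrans e z
    - h * ktrans (pqstep s (dir R k) e) z| <= C * h ^+ 2 * kmean z.
Proof.
have [C C0 hC] := kerpq_taylor s0 e (enorm_dir k).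
exists C => // z h hz hh; have := gamma1 => g1.
have h1 : - (3 / 4) <= z.1 by lra.
have h2 : - (3 / 4) <= (z + h *: dir R k).1.
  move: hh; rewrite ler_norml => /andP[? ?].
  by case: (k); rewrite /= /GRing.scale /=; lra.
have d1 := kdom_kerpq e h1; have d2 := kdom_kerpq e h2.
have d3 := kdom_kerpq (pqstep s (dir R k) e) h1.
have d12 := kdom_lin (-1) d1 d2; have d := kdom_lin (- h) d3 d12.
have -> : ktrans e (z + h *: dir R k) - ktrans e z
    - h * ktrans (pqstep s (dir R k) e) z =
    - h * ktrans (pqstep s (dir R k) e) z + (-1 * ktrans e z + ktrans e (z + h *: dir R k)).
  by ring.
rewrite /ktrans -!mu_lin// /kmean -muZ; last exact: kdom_ker.
apply: mu_abs; [exact: d|exact/kdomZ/kdom_ker|].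
move=> beta hb; rewrite [X in `|X|](_ : _ = kerpq s e (z + beta + h *: dir R k)
    - kerpq s e (z + beta) - h * kerpq s (pqstep s (dir R k) e) (z + beta)).
  by apply: hC => //; move: hz hb; rewrite /=; lra.
by rewrite [z + _ + beta]addrAC; ring.
Qed.

Lemma ktrans_le e : exists2 C, 0 <= C &
  forall z, - (1 / 2) <= z.1 -> `|ktrans e z| <= C * kmean z.
Proof.
have [C C0 hC] := kerpq_bound s e; exists C => // z hz; have := gamma1 => g1.
have h1 : - (3 / 4) <= z.1 by lra.
rewrite /kmean -muZ; last exact: kdom_ker.
apply: mu_abs; [exact: kdom_kerpq|exact/kdomZ/kdom_ker|].
by move=> beta hb; apply: hC; move: hz hb; rewrite /=; lra.
Qed.

Lemma ktrans_is_derive e k z : - (1 / 2) < z.1 ->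
  is_derive z (dir R k) (ktrans e) (ktrans (pqstep s (dir R k) e) z).
Proof.
move=> hz; have [C C0 hC] := ktrans_taylor e k.
apply: (@quadratic_is_derive _ _ _ _ _ (C * kmean z)) => h hh.
by rewrite mulrAC hC// ltW.
Qed.

Lemma ktrans_lip e k : exists2 C, 0 <= C & forall z h,
  - (1 / 2) <= z.1 -> `|h| <= 1 / 4 ->
  `|ktrans e (z + h *: dir R k) - ktrans e z| <= C * `|h| * kmean z.
Proof.
have [C C0 hC] := ktrans_taylor e k.
have [D D0 hD] := ktrans_le (pqstep s (dir R k) e).
exists (C + D) => [|z h hz hh]; first exact: addr_ge0.
have v0 := kmean_gt0 hz.
have := hC z h hz hh; have := hD z hz.
set a := ktrans _ _; set b := ktrans _ _ - _; rewrite -/b => ha hb.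
have hhb : `|h| ^+ 2 <= `|h| by have := normr_ge0 h; nra.
rewrite -[b](subrK (h * a)); apply: le_trans (ler_normD _ _) _.
rewrite !mulrDl; apply: lerD.
  apply: le_trans hb _; rewrite -[h ^+ 2]real_normK ?num_real//.
  by rewrite ler_pM2r// ler_wpM2l.
by rewrite normrM [D * _]mulrC -mulrA ler_wpM2l.
Qed.

Lemma kmeanE : kmean = ktrans (PQconst 1).
Proof.
by apply/funext => z; congr mu; apply/funext => beta; rewrite /kerpq /= mul1r.
Qed.

(** A nearby w is reached by a horizontal and then a vertical step, each controlled by [ktrans_lip].
    The bound for the second step involves [kmean] at the corner z', which is itself compared with
    [kmean z]. *)
Lemma ktrans_continuous e z : - (1 / 4) < z.1 -> {for z, continuous (ktrans e)}.
Proof.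
move=> hz.
have [C C0 hC] := ktrans_lip e true; have [D D0 hD] := ktrans_lip e false.
have [K K0 hK] := ktrans_lip (PQconst 1) true.
have hz2 : - (1 / 2) <= z.1 by lra.
have v0 := kmean_gt0 hz2.
have [M [M0 ME]] : exists M, 0 <= M /\ (C + D * (1 + K)) * kmean z = M.
  by exists ((C + D * (1 + K)) * kmean z); split; rewrite ?mulr_ge0 ?addr_ge0 ?mulr_ge0 ?addr_ge0// ltW.
apply/cvgrPdist_le => /= eps eps0.
have [d [d0 dl1 dl2]] : exists d, [/\ 0 < d, d <= 1 / 4 & d * (M + 1) <= eps].
  exists (Num.min (1 / 4) (eps / (M + 1))); split.
  - by rewrite lt_min !divr_gt0// ltr_wpDl.
  - by rewrite ge_min lexx.
  - by rewrite -ler_pdivlMr ?ltr_wpDl// ge_min lexx orbT.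
near=> w.
have dz1 : `|z.1 - w.1| <= d.
  near: w; apply: (near_fst (P := fun t => `|z.1 - t| <= d)).
  exact: near_dist_le.
have dz2 : `|z.2 - w.2| <= d.
  near: w; apply: (near_snd (P := fun t => `|z.2 - t| <= d)).
  exact: near_dist_le.
have [h1 h1E] : exists h, h = w.1 - z.1 by eexists.
have [h2 h2E] : exists h, h = w.2 - z.2 by eexists.
rewrite distrC -h1E in dz1; rewrite distrC -h2E in dz2.
pose z' := z + h1 *: dir R true.
have z'1 : z'.1 = w.1 by rewrite /z' /= /GRing.scale /= h1E; ring.
have wE : w = z' + h2 *: dir R false.
  rewrite [LHS]surjective_pairing [RHS]surjective_pairing; congr (_, _).
    by rewrite /z' /= /GRing.scale /= h1E; ring.
  by rewrite /z' /= /GRing.scale /= h2E; ring.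
have hz' : - (1 / 2) <= z'.1.
  rewrite z'1; have := le_trans dz1 dl1; rewrite ler_norml h1E; lra.
have e1 := hC z h1 hz2 (le_trans dz1 dl1).
have e2 := hD z' h2 hz' (le_trans dz2 dl1).
have e3 := hK z h1 hz2 (le_trans dz1 dl1).
rewrite -kmeanE -/z' in e1 e3; rewrite distrC wE.
rewrite -[X in `|X|](subrKA (ktrans e z')).
apply: le_trans (ler_normD _ _) _.
have kz' : kmean z' <= (1 + K) * kmean z.
  move: e3; rewrite ler_norml => /andP[_ e3].
  rewrite mulrDl mul1r -lerBlDl; apply: le_trans e3 _.
  rewrite ler_pM2r// ler_piMr//; apply: le_trans (le_trans dz1 dl1) _.
  by rewrite ler_pdivrMr// mul1r ler1n.
have b1 : C * `|h1| * kmean z <= C * d * kmean z by rewrite ler_pM2r// ler_wpM2l.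
have b2 : D * `|h2| * kmean z' <= D * d * ((1 + K) * kmean z).
  apply: ler_pM; rewrite ?mulr_ge0 ?ler_wpM2l//.
  by apply: ltW; exact: kmean_gt0.
apply: (@le_trans _ _ (d * M)).
  rewrite -ME addrC; apply: le_trans (lerD (le_trans e1 b1) (le_trans e2 b2)) _.
  by rewrite le_eqVlt; apply/orP; left; apply/eqP; ring.
by apply: le_trans dl2; rewrite ler_pM2l// lerDl.
Unshelve. all: by end_near. Qed.

(** Mirrors [Dw]: the head of the word is the outermost derivative. *)
Definition pqword w e : pqpoly R := foldr (fun k => pqstep s (dir R k)) e w.

(** Differentiating the induction hypothesis requires it near z, hence the open half-plane. *)
Lemma Dw_ktrans w e z : - (1 / 2) < z.1 ->
  Dw w (ktrans e) z = ktrans (pqword w e) z.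
Proof.
elim: w z => [//|k w IH] z hz /=; rewrite /pd.
have D := ktrans_is_derive (pqword w e) k hz.
rewrite -(@derive_val _ _ _ _ _ _ _ D); apply: near_eq_derive.
near=> y; apply: IH; near: y.
by apply: (near_fst (P := fun t => - (1 / 2) < t)); exact: lt_nbhsr.
Unshelve. all: by end_near. Qed.

Lemma derivable_Dw_ktrans w e k z : - (1 / 2) < z.1 ->
  derivable (Dw w (ktrans e)) z (dir R k).
Proof.
move=> hz; have [D _] := ktrans_is_derive (pqword w e) k hz.
apply: near_eq_derivable D; near=> y; apply/esym/Dw_ktrans; near: y.
by apply: (near_fst (P := fun t => - (1 / 2) < t)); exact: lt_nbhsr.
Unshelve. all: by end_near. Qed.

End KernelTransform.
(** * Bounds for the derivatives *)

Section RatioPolynomials.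
Variables (R : realType) (s gamma : R).
Implicit Types (p q : R) (lo hi : R).

Definition pqseq (k : bool) (j : nat) : pqpoly R :=
  pqword s (nseq j k) (PQconst 1).

(** If Re(z + beta) >= gamma, then p - iq = 1/(z + beta) lies in the closed disc with diameter
    [0, 1/gamma], which is the domain used here. *)
Definition pq_between (e : pqpoly R) lo hi : Prop := forall p q,
  0 <= p -> gamma * (p ^+ 2 + q ^+ 2) <= p -> lo <= pqeval e p q <= hi.

Lemma pqevalx1 p q : pqeval (pqseq true 1) p q = - (2 * s * p).
Proof. rewrite /pqseq /=; ring. Qed.

Lemma pqevalx2 p q :
  pqeval (pqseq true 2) p q = 2 * s * ((2 * s + 1) * p ^+ 2 - q ^+ 2).
Proof. rewrite /pqseq /=; ring. Qed.

Lemma pqevalx3 p q : pqeval (pqseq true 3) p q =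
  4 * s * (s + 1) * (p * (3 * q ^+ 2 - (2 * s + 1) * p ^+ 2)).
Proof. rewrite /pqseq /=; ring. Qed.

(** Up to 4s(s + 1), both fourth derivatives are this form in n = p^2 + q^2 and a, with a = p^2 or a
    = q^2. *)
Definition quartic (n a : R) : R :=
  3 * n ^+ 2 - 12 * (s + 2) * a * n + 4 * (s + 2) * (s + 3) * a ^+ 2.

Lemma pqevalx4 p q : pqeval (pqseq true 4) p q =
  4 * s * (s + 1) * quartic (p ^+ 2 + q ^+ 2) (p ^+ 2).
Proof. rewrite /pqseq /quartic /=; ring. Qed.

Lemma pqevaly1 p q : pqeval (pqseq false 1) p q = - (2 * s * q).
Proof. rewrite /pqseq /=; ring. Qed.

Lemma pqevaly2 p q :
  pqeval (pqseq false 2) p q = 2 * s * ((2 * s + 1) * q ^+ 2 - p ^+ 2).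
Proof. rewrite /pqseq /=; ring. Qed.

Lemma pqevaly3 p q : pqeval (pqseq false 3) p q =
  4 * s * (s + 1) * (q * (3 * p ^+ 2 - (2 * s + 1) * q ^+ 2)).
Proof. rewrite /pqseq /=; ring. Qed.

Lemma pqevaly4 p q : pqeval (pqseq false 4) p q =
  4 * s * (s + 1) * quartic (p ^+ 2 + q ^+ 2) (q ^+ 2).
Proof. rewrite /pqseq /quartic /=; ring. Qed.

End RatioPolynomials.

(** * Polynomial inequalities on the disc p^2 + q^2 <= g p, where g stands for 1/gamma *)

Section PolynomialBounds.
Variable R : realType.

Lemma quartic_between (s n a : R) : 0 < s -> 0 <= a -> a <= n ->
  - (3 * s + 3) * n ^+ 2 <= quartic s n a <= (2 * s + 1) * (2 * s + 3) * n ^+ 2.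
Proof.
move=> s0 a0 an; rewrite -subr_ge0 -[X in _ && X]subr_ge0 /quartic.
rewrite [X in (0 <= X) && _](_ : _ =
  (s + 2) * (3 * (n - 2 * a) ^+ 2 + 4 * s * a ^+ 2)); last by ring.
rewrite [X in _ && (0 <= X)](_ : _ =
  4 * s * (s + 2) * n * (n - a) + 4 * (s + 2) * (s + 3) * (a * (n - a))); last by ring.
have na : 0 <= n - a by rewrite subr_ge0.
have n0 : 0 <= n by exact: le_trans an.
have s2 : 0 <= s + 2 by lra.
have s3 : 0 <= s + 3 by lra.
have s4 : 0 <= s by exact: ltW.
have s5 : 0 <= (n - 2 * a) ^+ 2 by exact: sqr_ge0.
have s6 : 0 <= a ^+ 2 by exact: sqr_ge0.
apply/andP; split; first by apply: mulr_ge0 => //; apply: addr_ge0;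
  [exact: mulr_ge0|apply: mulr_ge0 => //; exact: mulr_ge0].
by apply: addr_ge0; rewrite !mulr_ge0.
Qed.

Section Disc.
Variables s g p q : R.
Hypotheses (s0 : 0 < s) (g0 : 0 < g) (p0 : 0 <= p).
Hypothesis disc : p ^+ 2 + q ^+ 2 <= g * p.

Lemma disc_p : p <= g.
Proof.
have := disc; have := sqr_ge0 q; have := g0; have := p0; move=> *; nra.
Qed.

Lemma disc_sq : p ^+ 2 + q ^+ 2 <= g ^+ 2.
Proof. by apply: le_trans disc _; rewrite expr2 ler_pM2l ?disc_p. Qed.

Lemma disc_q2 : q ^+ 2 <= g ^+ 2 / 4.
Proof. have := disc; have := sqr_ge0 (p - g / 2); lra. Qed.

Lemma disc_q : `|q| <= g / 2.
Proof.
rewrite -(@ler_pXn2r _ 2) ?nnegrE// ?real_normK ?num_real//.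
  by rewrite expr_div_n (_ : 2 ^+ 2 = 4 :> R) ?disc_q2//; ring.
by rewrite divr_ge0 ?(ltW g0).
Qed.

Lemma disc_p2 : p ^+ 2 <= g ^+ 2.
Proof. by rewrite lerXn2r ?nnegrE ?p0 ?(ltW g0) ?disc_p. Qed.

Lemma disc_p3 : p ^+ 3 <= g ^+ 3.
Proof. by rewrite lerXn2r ?nnegrE ?p0 ?(ltW g0) ?disc_p. Qed.

Lemma disc_q3 : `|q| ^+ 3 <= g ^+ 3 / 8.
Proof.
have g2 : 0 <= g / 2 by rewrite divr_ge0 ?(ltW g0).
have := @lerXn2r _ 3 `|q| (g / 2); rewrite !nnegrE normr_ge0 g2 disc_q.
move=> /(_ isT isT isT); rewrite expr_div_n.
by rewrite (_ : 2 ^+ 3 = 8 :> R)//; ring.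
Qed.

(** Inserting q^2 <= g p - p^2 leaves (2s + 2) p^2 - g p, which is minimal at p = g / (4 (s +
    1)). *)
Lemma disc_x2 : - (g ^+ 2 / (8 * (s + 1))) <= (2 * s + 1) * p ^+ 2 - q ^+ 2.
Proof.
have s1 : 0 < 8 * (s + 1) by have := s0; lra.
rewrite -mulNr ler_pdivrMr//.
have h : (2 * s + 2) * p ^+ 2 - g * p <= (2 * s + 1) * p ^+ 2 - q ^+ 2.
  by have := disc; lra.
apply: le_trans (ler_wpM2r (ltW s1) h).
have := sqr_ge0 (4 * (s + 1) * p - g); rewrite -subr_ge0 => h2; rewrite -subr_ge0.
by move: h2; congr (0 <= _); ring.
Qed.

(** Inserting q^2 <= g p - p^2 leaves 3 g p^2 - 2 (s + 2) p^3. For p >= 0 it is maximal at p = g /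
    (s + 2), the double root of the gap. *)
Lemma disc_x3 : p * (3 * q ^+ 2 - (2 * s + 1) * p ^+ 2) <= g ^+ 3 / (s + 2) ^+ 2.
Proof.
have s2 : 0 < s + 2 by have := s0; lra.
rewrite ler_pdivlMr ?exprn_gt0//.
have h : p * (3 * q ^+ 2 - (2 * s + 1) * p ^+ 2) <=
    p * (3 * (g * p - p ^+ 2) - (2 * s + 1) * p ^+ 2).
  by rewrite ler_wpM2l//; have := disc; lra.
apply: le_trans (ler_wpM2r _ h) _; first by rewrite ltW ?exprn_gt0.
have h2 : 0 <= (g - (s + 2) * p) ^+ 2 * (g + 2 * ((s + 2) * p)).
  by rewrite mulr_ge0 ?sqr_ge0// addr_ge0 ?(ltW g0)// !mulr_ge0// ltW.
by rewrite -subr_ge0; move: h2; congr (0 <= _); ring.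
Qed.

Lemma disc_y3 : 3 * p ^+ 2 * `|q| <= 25 * Num.sqrt 5 / 72 * g ^+ 3.
Proof.
have r5 : 0 <= Num.sqrt (5 : R) by exact: sqrtr_ge0.
rewrite -(@ler_pXn2r _ 2) ?nnegrE ?mulr_ge0 ?exprn_ge0 ?(ltW g0) ?invr_ge0//.
rewrite [leRHS](_ : _ = 625 * Num.sqrt 5 ^+ 2 / 5184 * g ^+ 6); last by field.
rewrite sqr_sqrtr ?ler0n// exprMn real_normK ?num_real//.
have h : (3 * p ^+ 2) ^+ 2 * q ^+ 2 <= (3 * p ^+ 2) ^+ 2 * (g * p - p ^+ 2).
  by rewrite ler_wpM2l ?sqr_ge0//; have := disc; lra.
apply: le_trans h _.
(* The maximum of p^5 (g - p) on [0, g] is attained at p = 5g/6, and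
   9 * 5^5 / 6^6 = (25 sqrt 5 / 72)^2. *)
pose quart u := u ^+ 4 + 4 * g * u ^+ 3 + 15 * g ^+ 2 * u ^+ 2
  + 50 * g ^+ 3 * u + 125 * g ^+ 4.
(* With u = 6p, the gap times 5184 is u^6 - 6 g u^5 + 3125 g^6. It has a double root at u = 5g, with
   cofactor [quart u]. *)
have h2 u : 0 <= u -> 0 <= (u - 5 * g) ^+ 2 * quart u.
  move=> u0; apply: mulr_ge0; first exact: sqr_ge0.
  have n0 n : 0 <= n%:R :> R by exact: ler0n.
  have gn n : 0 <= g ^+ n by rewrite exprn_ge0// ltW.
  have un n : 0 <= u ^+ n by rewrite exprn_ge0.
  by rewrite /quart; repeat apply: addr_ge0; repeat apply: mulr_ge0;
    rewrite ?gn ?un ?n0 ?(ltW g0).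
have p60 : 0 <= 6 * p by rewrite mulr_ge0 ?ler0n.
have := divr_ge0 (h2 _ p60) (ler0n R 5184).
move=> h3; rewrite -subr_ge0; move: h3.
by congr (0 <= _); rewrite /quart; field.
Qed.

(** In absolute value this is a difference of two nonnegative terms, hence at most the larger of
    their bounds; this is where the maximum comes from. *)
Lemma disc_y3_abs : `|q * (3 * p ^+ 2 - (2 * s + 1) * q ^+ 2)| <=
  Num.max (25 * Num.sqrt 5 / 72) ((2 * s + 1) / 8) * g ^+ 3.
Proof.
have g3 : 0 < g ^+ 3 by exact: exprn_gt0.
have s1 : 0 <= 2 * s + 1 by have := s0; lra.
set m := Num.max _ _.
have hA : 3 * p ^+ 2 * `|q| <= m * g ^+ 3.
  by apply: le_trans disc_y3 _; rewrite ler_pM2r// le_max lexx.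
have hB : (2 * s + 1) * `|q| ^+ 3 <= m * g ^+ 3.
  apply: le_trans (ler_wpM2l s1 disc_q3) _.
  by rewrite mulrA mulrAC ler_pM2r// le_max lexx orbT.
have A0 : 0 <= 3 * p ^+ 2 * `|q| by rewrite !mulr_ge0 ?sqr_ge0.
have B0 : 0 <= (2 * s + 1) * `|q| ^+ 3 by rewrite mulr_ge0 ?exprn_ge0.
rewrite normrM -[q ^+ 2]real_normK ?num_real// -[X in X * _]normr_id -normrM.
rewrite [X in `|X|](_ : _ = 3 * p ^+ 2 * `|q| - (2 * s + 1) * `|q| ^+ 3); last by ring.
by rewrite ler_norml; apply/andP; split; lra.
Qed.

End Disc.
End PolynomialBounds.

(** * Bounds on the disc for each derivative *)

Section RatioBounds.
Variables (R : realType) (s gamma : R).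
Hypotheses (s0 : 0 < s) (gamma1 : 1 <= gamma).
Local Notation between := (pq_between gamma).
Local Notation pqseq := (pqseq s).

Let gamma0 : 0 < gamma.
Proof. exact: lt_le_trans gamma1. Qed.

Let discE (p q : R) : gamma * (p ^+ 2 + q ^+ 2) <= p ->
  p ^+ 2 + q ^+ 2 <= gamma^-1 * p.
Proof. by rewrite ler_pdivlMl. Qed.

Let g0 : 0 < gamma^-1.
Proof. by rewrite invr_gt0. Qed.

Lemma between_x1 : between (pqseq true 1) (- (2 * s / gamma)) 0.
Proof.
move=> p q p0 /discE h; rewrite pqevalx1 oppr_le0 lerN2.
by rewrite ler_pM2l ?(disc_p g0 p0 h)//= ?mulr_ge0// ?ltW// mulr_gt0.
Qed.

Lemma between_x2 : between (pqseq true 2)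
  (- (s / (4 * gamma ^+ 2 * (s + 1)))) (2 * s * (2 * s + 1) / gamma ^+ 2).
Proof.
move=> p q p0 /discE h; rewrite pqevalx2.
have s2 : 0 < 2 * s by rewrite mulr_gt0.
have hl := disc_x2 s0 h; have hu := disc_p2 g0 p0 h.
rewrite -(ler_pM2l s2) in hl; apply/andP; split.
  apply: le_trans hl; rewrite le_eqVlt; apply/orP; left; apply/eqP; field.
  by rewrite !gt_eqF//; have := s0; lra.
rewrite [leRHS](_ : _ = 2 * s * ((2 * s + 1) * gamma^-1 ^+ 2)); last first.
  by field; rewrite gt_eqF.
rewrite ler_pM2l//; apply: (@le_trans _ _ ((2 * s + 1) * p ^+ 2)).
  by rewrite gerBl sqr_ge0.
by rewrite ler_pM2l// addr_gt0.
Qed.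

Lemma between_x3 : between (pqseq true 3)
  (- (2 * s * (2 * s + 1) * (2 * s + 2) / gamma ^+ 3))
  ((2 * s) * (2 * s + 2) / (gamma ^+ 3 * (s + 2) ^+ 2)).
Proof.
move=> p q p0 /discE h; rewrite pqevalx3.
have c0 : 0 < 4 * s * (s + 1) by rewrite !mulr_gt0// addr_gt0.
have hu := disc_x3 s0 g0 p0 h; have hl := disc_p3 g0 p0 h.
apply/andP; split.
  rewrite [leLHS](_ : _ = 4 * s * (s + 1) * (- ((2 * s + 1) * gamma^-1 ^+ 3))); last first.
    by field; rewrite gt_eqF.
  rewrite ler_pM2l//.
  have s1 : 0 < 2 * s + 1 by rewrite addr_gt0// mulr_gt0.
  have : (2 * s + 1) * p ^+ 3 <= (2 * s + 1) * gamma^-1 ^+ 3 by rewrite ler_pM2l.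
  have : 0 <= p * q ^+ 2 by rewrite mulr_ge0 ?sqr_ge0.
  by lra.
rewrite [leRHS](_ : _ = 4 * s * (s + 1) * (gamma^-1 ^+ 3 / (s + 2) ^+ 2)); last first.
  by field; rewrite !gt_eqF//; have := s0; lra.
by rewrite ler_pM2l.
Qed.

Let between_quartic (p q a : R) : 0 <= p -> gamma * (p ^+ 2 + q ^+ 2) <= p ->
  0 <= a <= p ^+ 2 + q ^+ 2 ->
  - (2 * s * (2 * s + 2) * (3 * s + 3) / gamma ^+ 4) <=
    4 * s * (s + 1) * quartic s (p ^+ 2 + q ^+ 2) a <=
    (2 * s) * (2 * s + 1) * (2 * s + 2) * (2 * s + 3) / gamma ^+ 4.
Proof.
move=> p0 /discE h /andP[a0 an].
have c0 : 0 < 4 * s * (s + 1) by rewrite !mulr_gt0// addr_gt0.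
have /andP[hl hu] := quartic_between s0 a0 an.
have hn := disc_sq g0 p0 h.
have n0 : 0 <= p ^+ 2 + q ^+ 2 by rewrite addr_ge0 ?sqr_ge0.
have hn2 : (p ^+ 2 + q ^+ 2) ^+ 2 <= (gamma^-1 ^+ 2) ^+ 2.
  by rewrite lerXn2r ?nnegrE// exprn_ge0// ltW.
have s3 : 0 < 3 * s + 3 by have := s0; lra.
have s4 : 0 < (2 * s + 1) * (2 * s + 3) by have := s0; move=> ?; rewrite mulr_gt0//; lra.
apply/andP; split.
  rewrite [leLHS](_ : _ = 4 * s * (s + 1) * (- (3 * s + 3) * (gamma^-1 ^+ 2) ^+ 2)); last first.
    by field; rewrite gt_eqF.
  rewrite ler_pM2l//; apply: le_trans hl; rewrite !mulNr lerN2.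
  by rewrite ler_pM2l.
rewrite [leRHS](_ : _ =
    4 * s * (s + 1) * ((2 * s + 1) * (2 * s + 3) * (gamma^-1 ^+ 2) ^+ 2)); last first.
  by field; rewrite gt_eqF.
by rewrite ler_pM2l//; apply: le_trans hu _; rewrite ler_pM2l.
Qed.

Lemma between_x4 : between (pqseq true 4)
  (- (2 * s * (2 * s + 2) * (3 * s + 3) / gamma ^+ 4))
  ((2 * s) * (2 * s + 1) * (2 * s + 2) * (2 * s + 3) / gamma ^+ 4).
Proof.
move=> p q p0 h; rewrite pqevalx4; apply: between_quartic => //.
by rewrite sqr_ge0 lerDl sqr_ge0.
Qed.

Lemma between_y4 : between (pqseq false 4)
  (- (2 * s * (2 * s + 2) * (3 * s + 3) / gamma ^+ 4))
  ((2 * s) * (2 * s + 1) * (2 * s + 2) * (2 * s + 3) / gamma ^+ 4).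
Proof.
move=> p q p0 h; rewrite pqevaly4; apply: between_quartic => //.
by rewrite sqr_ge0 lerDr sqr_ge0.
Qed.

Lemma between_y1 : between (pqseq false 1) (- (s / gamma)) (s / gamma).
Proof.
move=> p q p0 /discE h; rewrite pqevaly1 -ler_norml normrN normrM gtr0_norm ?mulr_gt0//.
have := disc_q g0 h; rewrite -(ler_pM2l (_ : 0 < 2 * s)) ?mulr_gt0// => {}h.
apply: le_trans h _; rewrite le_eqVlt; apply/orP; left; apply/eqP; field.
by rewrite gt_eqF.
Qed.

Lemma between_y2 : between (pqseq false 2)
  (- (2 * s / gamma ^+ 2)) (2 * s * (2 * s + 1) / (4 * gamma ^+ 2)).
Proof.
move=> p q p0 /discE h; rewrite pqevaly2.
have s2 : 0 < 2 * s by rewrite mulr_gt0.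
have s1 : 0 < 2 * s + 1 by rewrite addr_gt0.
have hp := disc_p2 g0 p0 h; have hq := disc_q2 h.
have hq' : (2 * s + 1) * q ^+ 2 <= (2 * s + 1) * (gamma^-1 ^+ 2 / 4) by rewrite ler_pM2l.
have hq0 : 0 <= (2 * s + 1) * q ^+ 2 by rewrite mulr_ge0 ?sqr_ge0// ltW.
have hp0 := sqr_ge0 p.
apply/andP; split.
  rewrite [leLHS](_ : _ = 2 * s * (- gamma^-1 ^+ 2)); last first.
    by field; rewrite gt_eqF.
  by rewrite ler_pM2l//; lra.
rewrite [leRHS](_ : _ = 2 * s * ((2 * s + 1) * (gamma^-1 ^+ 2 / 4))); last first.
  by field; rewrite gt_eqF.
by rewrite ler_pM2l//; lra.
Qed.

Lemma between_y3 (c := (2 * s) * (2 * s + 2) / gamma ^+ 3 *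
    Num.max (25 * Num.sqrt 5 / 72) ((2 * s + 1) / 8)) :
  between (pqseq false 3) (- c) c.
Proof.
move=> p q p0 /discE h; rewrite pqevaly3 -ler_norml normrM.
have c0 : 0 < 4 * s * (s + 1) by rewrite !mulr_gt0// addr_gt0.
rewrite (gtr0_norm c0).
have hq := disc_y3_abs s0 g0 p0 h; rewrite -(ler_pM2l c0) in hq.
apply: le_trans hq _; rewrite le_eqVlt; apply/orP; left; apply/eqP; rewrite /c.
by field; rewrite gt_eqF.
Qed.

End RatioBounds.

(** * Comparison with the rising factorials *)

Section RisingFactorialBound.
Variables (R : realType) (s gamma : R).
Hypotheses (s0 : 0 < s) (gamma1 : 1 <= gamma).

Let gX0 n : 0 < (gamma ^+ n)^-1.
Proof. by rewrite invr_gt0 exprn_gt0// (lt_le_trans _ gamma1). Qed.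

(** Puts the maximum in the third y-derivative below 2s + 1. *)
Lemma sqrt5_bound : 25 * Num.sqrt (5 : R) / 72 <= 1.
Proof.
have r0 : 0 <= Num.sqrt (5 : R) by exact: sqrtr_ge0.
have r5 : Num.sqrt (5 : R) ^+ 2 = 5 by rewrite sqr_sqrtr// ler0n.
have : Num.sqrt (5 : R) <= 5 / 2 by nra.
lra.
Qed.

Lemma between_rising k j : (1 <= j <= 4)%N ->
  let c := (\prod_(i < j) (2 * s + i%:R)) / gamma ^+ j in
  exists lo hi, [/\ pq_between gamma (pqseq s k j) lo hi, - c <= lo & hi <= c].
Proof.
move=> hj c; have s1 := s0; have g1 := gamma1.
have g0 : gamma != 0 by rewrite gt_eqF// (lt_le_trans _ gamma1).
have s10 : 0 < s + 1 by lra.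
have s20 : 0 < s + 2 by lra.
have ss : 0 < s * s by rewrite mulr_gt0.
have gi : 0 < gamma^-1 by have := gX0 1; rewrite expr1.
case: j hj @c => [//|[|[|[|[|//]]]]] _; rewrite !big_ord_recr big_ord0 /= mul1r addr0.
- rewrite expr1; case: k; do 2 eexists; split.
  + exact: (between_x1 s0 gamma1).
  + by [].
  + by rewrite divr_ge0//; lra.
  + exact: (between_y1 s0 gamma1).
  + by rewrite lerN2 ler_pM2r//; lra.
  + by rewrite ler_pM2r//; lra.
- case: k; do 2 eexists; split.
  + exact: (between_x2 s0 gamma1).
  + rewrite lerN2 (_ : s / _ = s / (4 * (s + 1)) / gamma ^+ 2).
      by rewrite ler_pM2r// ler_pdivrMr; [nra|lra].
    by field; rewrite g0 gt_eqF.
  + by [].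
  + exact: (between_y2 s0 gamma1).
  + by rewrite lerN2 ler_pM2r//; nra.
  + rewrite (_ : _ / (4 * _) = 2 * s * (2 * s + 1) / 4 / gamma ^+ 2).
      by rewrite ler_pM2r//; nra.
    by field.
- case: k; do 2 eexists; split.
  + exact: (between_x3 s0 gamma1).
  + by [].
  + rewrite (_ : _ / (_ * (s + 2) ^+ 2) =
      2 * s * (2 * s + 2) / (s + 2) ^+ 2 / gamma ^+ 3).
      rewrite ler_pM2r// ler_pdivrMr ?exprn_gt0//.
      rewrite [leRHS](_ : _ = 2 * s * (2 * s + 2) * ((2 * s + 1) * (s + 2) ^+ 2)).
        by rewrite ler_peMr ?mulr_ege1 ?exprn_ege1 ?mulr_ge0//; lra.
      by ring.
    by field; rewrite g0 gt_eqF.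
  + exact: (between_y3 s0 gamma1).
  + rewrite lerN2 mulrAC ler_pM2r// [leRHS]mulrAC ler_pM2l; last nra.
    rewrite ge_max (le_trans sqrt5_bound); lra.
  + rewrite mulrAC ler_pM2r// [leRHS]mulrAC ler_pM2l; last nra.
    rewrite ge_max (le_trans sqrt5_bound); lra.
- have h : 2 * s * (2 * s + 2) * (3 * s + 3) / gamma ^+ 4 <=
      2 * s * (2 * s + 1) * (2 * s + 2) * (2 * s + 3) / gamma ^+ 4.
    rewrite ler_pM2r// [2 * s * (2 * s + 1) * _]mulrAC -[leRHS]mulrA ler_pM2l; nra.
  case: k; do 2 eexists; split.
  + exact: (between_x4 s0 gamma1).
  + by rewrite lerN2.
  + by [].
  + exact: (between_y4 s0 gamma1).
  + by rewrite lerN2.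
  + by [].
Qed.

End RisingFactorialBound.

(** * Uniqueness *)

Section InverseBranches.
Variable R : realType.
Implicit Types (z w b p : R * R) (gamma : R) (K : set (R * R)).

Lemma enorm_sub_eq0 z w : enorm (z - w) = 0 -> z = w.
Proof.
move=> e; have /eqP := enorm_sq (z - w); rewrite e expr0n /= eq_sym.
rewrite paddr_eq0 ?sqr_ge0// !sqrf_eq0 !subr_eq0 => /andP[/eqP h1 /eqP h2].
by rewrite [z]surjective_pairing [w]surjective_pairing h1 h2.
Qed.

(** theta_b(z) - theta_b(w) = (w - z) / ((z + b)(w + b)). *)
Lemma theta_sub z w b : 0 < (z + b).1 -> 0 < (w + b).1 ->
  enorm (theta b z - theta b w) * (enorm (z + b) * enorm (w + b)) = enorm (z - w).
Proof.
move=> z0 w0; have := sqnorm_gt0 z0; have := sqnorm_gt0 w0 => /= h1 h2.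
apply/eqP; rewrite -(@eqrXn2 _ 2) ?mulr_ge0 ?enorm_ge0//; apply/eqP.
rewrite !exprMn !enorm_sq /=.
by field; rewrite !gt_eqF.
Qed.

Lemma theta_Re_gt0 z b : 0 < (z + b).1 -> 0 < (theta b z).1.
Proof. exact: cinv_Re_gt0. Qed.

(** Inversion carries the half-plane Re > gamma into the disc. *)
Lemma theta_Ggamma gamma z b : 1 <= gamma -> gamma <= b.1 -> 0 < z.1 ->
  Ggamma gamma (theta b z).
Proof.
move=> g1 bg z0; have zb : gamma < (z + b).1 by rewrite /=; lra.
have zb0 : 0 < (z + b).1 by lra.
have := sqnorm_gt0 zb0 => /= n0.
have g0 : 0 < (2 * gamma)^-1 by rewrite invr_gt0; lra.
rewrite /Ggamma /= -(@ltr_pXn2r _ 2) ?nnegrE ?enorm_ge0 ?(ltW g0)// enorm_sq.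
rewrite -subr_gt0 /=.
set x := z.1 + b.1 in n0 *; set y := z.2 + b.2 in n0 *.
rewrite (_ : _ - _ = (x / gamma - 1) / (x ^+ 2 + y ^+ 2)).
  by rewrite divr_gt0// subr_gt0 ltr_pdivlMr ?mul1r//; lra.
by field; rewrite !gt_eqF//; lra.
Qed.

Lemma theta_continuous b z : 0 < (z + b).1 -> {for z, continuous (theta b)}.
Proof.
move=> zb0; have := sqnorm_gt0 zb0 => /= n0.
have c1 : (y.1 + b.1) @[y --> z] --> z.1 + b.1.
  apply: cvgD; last exact: cvg_cst.
  exact: (@cvg_fst _ _ (nbhs z.1) (nbhs z.2)).
have c2 : (y.2 + b.2) @[y --> z] --> z.2 + b.2.
  apply: cvgD; last exact: cvg_cst.
  exact: (@cvg_snd _ _ (nbhs z.1) (nbhs z.2)).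
have cn : ((y.1 + b.1) * (y.1 + b.1) + (y.2 + b.2) * (y.2 + b.2))^-1 @[y --> z] -->
    ((z.1 + b.1) * (z.1 + b.1) + (z.2 + b.2) * (z.2 + b.2))^-1.
  by apply: cvgV; [rewrite gt_eqF|apply: cvgD; apply: cvgM].
apply: (@cvg_pair _ _ _ _ (nbhs (theta b z).1) (nbhs (theta b z).2)).
  exact: cvgM c1 cn.
by apply: cvgM cn; apply: cvgN.
Qed.

Lemma enorm_continuous z : {for z, continuous (@enorm R)}.
Proof.
have c1 : y.1 @[y --> z] --> z.1 by exact: (@cvg_fst _ _ (nbhs z.1) (nbhs z.2)).
have c2 : y.2 @[y --> z] --> z.2 by exact: (@cvg_snd _ _ (nbhs z.1) (nbhs z.2)).
have cn : (y.1 * y.1 + y.2 * y.2) @[y --> z] --> z.1 * z.1 + z.2 * z.2.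
  by apply: cvgD; apply: cvgM.
exact: continuous_cvg (@sqrt_continuous R _) cn.
Qed.

Lemma theta_fixpoint K gamma b : 1 <= gamma -> gamma <= b.1 ->
  compact K -> K !=set0 -> (forall z, K z -> 0 <= z.1) ->
  (forall z, K z -> K (theta b z)) ->
  exists p, [/\ K p, theta b p = p & 0 < p.1].
Proof.
move=> g1 bg cK K0 Kre Ktheta.
have Kzb z : K z -> 0 < (z + b).1 by move=> /Kre h; rewrite /=; lra.
have cD : {within K, continuous (fun z => enorm (theta b z - z))}.
  apply: continuous_in_subspaceT => z /set_mem Kz.
  apply: (@continuous_cvg _ _ _ _ _ (fun z => theta b z - z) (@enorm R)).
    exact: enorm_continuous.
  by apply: cvgB; [exact: theta_continuous (Kzb _ Kz)|exact: cvg_id].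
(* theta b does not increase distances, and strictly decreases them once
   Re > 0, which holds after one step; so the minimal displacement is 0. *)
have [z /set_mem Kz zmin] := compact_EVT_min K0 cK cD.
have {}zmin w : K w -> enorm (theta b z - z) <= enorm (theta b w - w).
  by move=> Kw; apply: zmin; exact: mem_set.
pose w := theta b z.
have Kw : K w by exact: Ktheta.
have w0 : 0 < w.1 by exact: theta_Re_gt0 (Kzb _ Kz).
(* The image w is chosen rather than the minimiser z, since Re w > 0 is known while Re z may vanish
   a priori. *)
exists w; split => //.
have e1 := theta_sub (Kzb _ Kw) (Kzb _ Kz).
have e2 := theta_sub (Kzb _ (Ktheta _ Kw)) (Kzb _ Kw).
rewrite -/w in e1.
have ez : 1 <= enorm (z + b).
  by apply: le_trans (Re_le_enorm _); have := Kre _ Kz; rewrite /=; lra.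
have ew : 1 < enorm (w + b).
  by apply: lt_le_trans (Re_le_enorm _); move: (w) w0 => t; rewrite /=; lra.
have et : 1 <= enorm (theta b w + b).
  apply: le_trans (Re_le_enorm _); have := Kre _ (Ktheta _ Kw).
  by move: (theta b w) => t; rewrite /=; lra.
have m := zmin _ (Ktheta _ Kw).
have d0 : enorm (w - z) = 0.
  move: e1 e2 m ez ew et; rewrite -/w.
  move: (enorm_ge0 (theta b w - w)) (enorm_ge0 (theta b (theta b w) - theta b w)).
  move: (enorm (theta b w - w)) (enorm (theta b (theta b w) - theta b w)).
  move: (enorm (w - z)) (enorm (z + b)) (enorm (w + b)) (enorm (theta b w + b)).
  move=> d ez ew et d1 d2 d1_ge0 d2_ge0 e1 e2 m hez hew het.
  have d1d : d1 <= d by rewrite -e1 ler_peMr// mulr_ege1// ltW.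
  apply/eqP; rewrite eq_le; apply/andP; split; last exact: le_trans d1d.
  rewrite leNgt; apply/negP => d_gt0.
  have d2_gt0 : 0 < d2 by exact: lt_le_trans m.
  have : d2 < d1.
    rewrite -e2 ltr_pMr//; apply: (lt_le_trans hew).
    by rewrite ler_peMl//; lra.
  by rewrite ltNge (le_trans d1d).
have e3 : enorm (theta b w - w) = 0.
  rewrite d0 in e1; move/eqP: e1.
  by rewrite mulf_eq0 [X in _ || X]gt_eqF ?orbF ?mulr_gt0 => [/eqP|||]//; lra.
exact: enorm_sub_eq0 e3.
Qed.

(** By [theta_sub] at the fixed point, each step divides the distance to p by at least |p + b| >
    1. *)
Lemma theta_orbit_cvg gamma b p z : 1 <= gamma -> gamma <= b.1 ->
  theta b p = p -> 0 < p.1 -> 0 <= z.1 ->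
  (forall n, 0 <= (iter n (theta b) z).1) /\
  iter n (theta b) z @[n --> \oo] --> p.
Proof.
move=> g1 bg fp p0 z0.
have pos n : 0 <= (iter n (theta b) z).1.
  elim: n => // n IH /=; apply/ltW/theta_Re_gt0; rewrite /=; lra.
split=> //; pose q := (enorm (p + b))^-1.
have pb : 1 < enorm (p + b) by apply: lt_le_trans (Re_le_enorm _); rewrite /=; lra.
have q0 : 0 < q by rewrite invr_gt0; lra.
have q1 : `|q| < 1 by rewrite gtr0_norm// invf_lt1//; lra.
have rate n : enorm (iter n (theta b) z - p) <= geometric (enorm (z - p)) q n.
  elim: n => [|n IH] /=; first by rewrite expr0 mulr1.
  set w := iter n (theta b) z in IH *.
  have wn : 0 <= w.1 by exact: pos.
  have w1 : 1 <= enorm (w + b) by apply: le_trans (Re_le_enorm _); rewrite /=; lra.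
  have e := @theta_sub w p b; rewrite fp in e.
  rewrite exprSr mulrA ler_pdivlMr; last by lra.
  apply: le_trans IH; rewrite -e; [|by rewrite /=; lra|by rewrite /=; lra].
  rewrite mulrA ler_pM2r; last by lra.
  by rewrite ler_peMr// enorm_ge0.
have cg := @cvg_geometric R (enorm (z - p)) q q1.
have absR1 w : `|w.1| <= enorm w.
  rewrite ler_norml Re_le_enorm andbT lerNl.
  by rewrite -[X in _ <= X]enormN; exact: (Re_le_enorm (- w)).
have absR2 w : `|w.2| <= enorm w.
  have -> : enorm w = enorm (w.2, w.1) by rewrite /enorm /= addrC.
  exact: (absR1 (w.2, w.1)).
have c (f : R * R -> R) : (forall w, `|f w| <= enorm w) ->
    (forall u w, f (u - w) = f u - f w) ->
    f (iter n (theta b) z) @[n --> \oo] --> f p.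
  move=> fabs fB; apply/subr_cvg0/norm_cvg0P.
  apply: (@squeeze_cvgr _ _ _ _ (fun=> 0) (geometric (enorm (z - p)) q)) => //.
    by apply: filterE => n; rewrite normr_ge0 /= -fB (le_trans (fabs _)).
  exact: cvg_cst.
rewrite [X in X @ _ --> _](_ : _ =
    (fun n => ((iter n (theta b) z).1, (iter n (theta b) z).2))).
  rewrite [X in _ --> X]surjective_pairing.
  apply: (@cvg_pair _ _ _ _ (nbhs p.1) (nbhs p.2)); first exact: (c fst).
  exact: (c snd).
by apply/funext => n; rewrite -surjective_pairing.
Qed.

Lemma within_cvg_seq K (g : R * R -> R) (u : nat -> R * R) p :
  {within K, continuous g} -> K p -> (forall n, K (u n)) ->
  u @ \oo --> p -> g (u n) @[n --> \oo] --> g p.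
Proof.
move=> /subspace_continuousP cg Kp Ku up; apply: cvg_trans (cg p Kp) => A.
move=> h; have := up _ h; rewrite /fmap /= /nbhs /=.
by apply: filterS => n /(_ (Ku n)).
Qed.

End InverseBranches.

(** * Comparison of two positive eigenfunctions *)

Section Uniqueness.
Variables (R : realType) (s gamma : R) (B : seq (R * R)) (K : set (R * R)).
Implicit Types (z w b p : R * R) (f g h : R * R -> R).
Hypotheses (gamma1 : 1 <= gamma) (B0 : B != [::]).
Hypothesis Bgamma : forall b, b \in B -> gamma <= b.1.
Hypotheses (cK : compact K) (K0 : K !=set0).
Hypothesis Kre : forall z, K z -> 0 <= z.1.
Hypothesis Ktheta : forall b z, b \in B -> K z -> K (theta b z).

Lemma Lambda_lin f g c z :
  Lambda s B (fun w => c * f w + g w) z = c * Lambda s B f z + Lambda s B g z.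
Proof.
rewrite /Lambda mulr_sumr -big_split /=; apply: eq_bigr => b _.
by rewrite mulrDr mulrCA.
Qed.

Lemma Lambda_ge0 h z : (forall w, K w -> 0 <= h w) -> K z -> 0 <= Lambda s B h z.
Proof.
move=> h0 Kz; rewrite /Lambda big_seq sumr_ge0// => b bB.
by rewrite mulr_ge0 ?powR_ge0// h0//; exact: Ktheta.
Qed.

(** A sum of nonnegative terms vanishes only termwise, and the weights are positive. *)
Lemma Lambda_eq0_theta h z b : (forall w, K w -> 0 <= h w) -> K z ->
  Lambda s B h z = 0 -> b \in B -> h (theta b z) = 0.
Proof.
move=> h0 Kz /eqP; rewrite /Lambda big_seq psumr_eq0 => [/allP sum0 bB|b' b'B].
  have := sum0 b bB; rewrite bB /= mulf_eq0 gt_eqF /= => [/eqP//|].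
  apply: ker_gt0; have := Bgamma bB; have := Kre Kz; have := gamma1.
  by rewrite /=; lra.
by rewrite mulr_ge0 ?powR_ge0// h0//; exact: Ktheta.
Qed.

Lemma eigenfunction_unique f g lam rho :
  {within K, continuous f} -> {within K, continuous g} ->
  (forall z, K z -> 0 < f z) -> (forall z, K z -> 0 < g z) ->
  (forall z, K z -> Lambda s B f z = lam * f z) ->
  (forall z, K z -> Lambda s B g z = rho * g z) ->
  exists c, 0 < c /\ forall z, K z -> f z = c * g z.
Proof.
move=> cf cg f0 g0 ef eg.
have cr : {within K, continuous (fun z => f z / g z)}.
  apply/subspace_continuousP => z Kz.
  have /subspace_continuousP/(_ z Kz) cfz := cf.
  have /subspace_continuousP/(_ z Kz) cgz := cg.
  by apply: cvgM cfz _; apply: cvgV => //; rewrite gt_eqF// g0.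
have [z0 /set_mem Kz0 zmin] := compact_EVT_min K0 cK cr.
have [z1 /set_mem Kz1 zmax] := compact_EVT_max K0 cK cr.
set c := f z0 / g z0 in zmin; set C := f z1 / g z1 in zmax.
have fc z : K z -> 0 <= - c * g z + f z.
  move=> Kz; have := zmin z (mem_set Kz).
  by rewrite ler_pdivlMr ?g0// mulNr addrC subr_ge0.
have fC z : K z -> 0 <= C * g z + -1 * f z.
  move=> Kz; have := zmax z (mem_set Kz).
  by rewrite ler_pdivrMr ?g0// mulN1r subr_ge0.
have fz0 : f z0 = c * g z0 by rewrite divfK// gt_eqF// g0.
have fz1 : f z1 = C * g z1 by rewrite divfK// gt_eqF// g0.
have c0 : 0 < c by rewrite divr_gt0 ?f0 ?g0.
have C0 : 0 < C by rewrite divr_gt0 ?f0 ?g0.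
(* The nonnegative functions C g - f and f - c g vanish at z1 and z0. Since [Lambda] is positive,
   evaluating it there gives lam <= rho and rho <= lam. *)
have lamE : lam = rho.
  apply/eqP; rewrite eq_le; apply/andP; split.
    have := Lambda_ge0 fC Kz1; rewrite Lambda_lin eg//.
    have -> : Lambda s B (fun w => -1 * f w) z1 = - (lam * f z1).
      rewrite -ef// /Lambda -sumrN; apply: eq_bigr => b _.
      by rewrite mulN1r mulrN.
    rewrite fz1 (_ : _ - _ = (rho - lam) * (C * g z1)); last by ring.
    by rewrite pmulr_lge0 ?subr_ge0// mulr_gt0// g0.
  have := Lambda_ge0 fc Kz0; rewrite Lambda_lin eg// ef// fz0.
  rewrite (_ : _ + _ = (lam - rho) * (c * g z0)); last by ring.
  by rewrite pmulr_lge0 ?subr_ge0// mulr_gt0// g0.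
have [b bB] : exists b, b \in B.
  by case: (B) B0 => // b B' _; exists b; rewrite mem_head.
have [p [Kp fp p0]] := theta_fixpoint gamma1 (Bgamma bB) cK K0 Kre
  (fun z Kz => Ktheta bB Kz).
(* A zero of a nonnegative eigenfunction is passed on along the orbit of [theta b] and, by
   continuity, to its limit p. *)
have orbit h z : (forall w, K w -> 0 <= h w) -> {within K, continuous h} ->
    (forall w, K w -> Lambda s B h w = rho * h w) -> K z -> h z = 0 -> h p = 0.
  move=> h0 ch eh Kz hz.
  have Kn n : K (iter n (theta b) z) by elim: n => //= n; exact: Ktheta.
  have hn n : h (iter n (theta b) z) = 0.
    elim: n => //= n IH; apply: (Lambda_eq0_theta h0 (Kn n)) => //.
    by rewrite eh// IH mulr0.
  have [_ cvgp] := theta_orbit_cvg gamma1 (Bgamma bB) fp p0 (Kre Kz).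
  have := within_cvg_seq ch Kp Kn cvgp.
  rewrite [X in X @ _ --> _](_ : _ = fun=> 0); last by apply/funext.
  by move/cvg_lim => <-//; rewrite lim_cst.
have cB (a d : R) : {within K, continuous (fun z => a * g z + d * f z)}.
  apply/subspace_continuousP => z Kz.
  have /subspace_continuousP/(_ z Kz) cfz := cf.
  have /subspace_continuousP/(_ z Kz) cgz := cg.
  by apply: cvgD; apply: cvgMl_tmp.
have eB (a d : R) z : K z ->
    Lambda s B (fun z => a * g z + d * f z) z = rho * (a * g z + d * f z).
  move=> Kz; rewrite Lambda_lin eg//.
  have -> : Lambda s B (fun w => d * f w) z = d * (lam * f z).
    rewrite -ef// /Lambda mulr_sumr; apply: eq_bigr => b' _.
    by rewrite mulrCA.
  by rewrite lamE; ring.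
have hc : - c * g p + 1 * f p = 0.
  apply: (orbit (fun z => - c * g z + 1 * f z) z0) => //.
  - by move=> w Kw; rewrite mul1r; exact: fc.
  - by move=> w; exact: eB.
  - by rewrite fz0; ring.
have hC : C * g p + -1 * f p = 0.
  apply: (orbit (fun z => C * g z + -1 * f z) z1) => //.
  - by move=> w; exact: eB.
  - by rewrite fz1; ring.
have cC : c = C.
  have gp : g p != 0 by rewrite gt_eqF ?g0.
  by apply: (mulIf gp); lra.
exists c; split=> // z Kz; have := fc z Kz; have := fC z Kz; rewrite -cC.
lra.
Qed.

End Uniqueness.
(** * The eigenfunction on the closure *)

Section KernelTransformEigen.
Variables (R : realType) (s gamma : R) (B : seq (R * R)).
Variable mu : (R * R -> R) -> R.
Implicit Types (z b beta : R * R) (phi psi : R * R -> R) (H : set (R * R)).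
Hypotheses (s0 : 0 < s) (gamma1 : 1 <= gamma).
Hypothesis Bgamma : forall b, b \in B -> gamma <= b.1.
Hypothesis mu_lin : forall c phi psi, kdom s gamma phi -> kdom s gamma psi ->
  mu (fun beta => c * phi beta + psi beta) = c * mu phi + mu psi.
Hypothesis mu_le : forall phi psi, kdom s gamma phi -> kdom s gamma psi ->
  (forall beta, gamma <= beta.1 -> phi beta <= psi beta) -> mu phi <= mu psi.
Hypothesis mu_ker : 0 < mu (ker s).

Lemma mu_sum (r : seq (R * R)) (c : R * R -> R) (f : R * R -> R * R -> R) :
  (forall b, b \in r -> kdom s gamma (f b)) ->
  kdom s gamma (fun beta => \sum_(b <- r) c b * f b beta) /\
  mu (fun beta => \sum_(b <- r) c b * f b beta) = \sum_(b <- r) c b * mu (f b).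
Proof.
elim: r => [_|b r IH hf].
  have -> : (fun beta => \sum_(b <- [::]) c b * f b beta) = fun=> 0.
    by apply/funext => beta; rewrite big_nil.
  by rewrite big_nil; split; [exact: kdom0|exact: mu0 mu_lin].
have hr b' : b' \in r -> kdom s gamma (f b').
  by move=> b'r; apply: hf; rewrite in_cons b'r orbT.
have [kr mr] := IH hr.
have kb := hf b (mem_head _ _).
have -> : (fun beta => \sum_(b' <- b :: r) c b' * f b' beta) =
    fun beta => c b * f b beta + \sum_(b <- r) c b * f b beta.
  by apply/funext => beta; rewrite big_cons.
by rewrite big_cons -mr -mu_lin//; split=> //; exact: kdom_lin.
Qed.

(** Under [mu], [Lambda] acting in z becomes [dualop] acting in the pole, by [dualop_ker]. *)
Lemma Lambda_kmean rho z :
  (forall phi, kdom s gamma phi -> mu (dualop s B phi) = rho * mu phi) ->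
  0 <= z.1 -> Lambda s B (kmean s mu) z = rho * kmean s mu z.
Proof.
move=> mu_inv z0; have g1 := gamma1.
have kz : kdom s gamma (fun beta => ker s (z + beta)).
  by apply: (kdom_ker s0 gamma1); lra.
have kt b : b \in B -> kdom s gamma (fun beta => ker s (theta b z + beta)).
  move=> bB; apply: (kdom_ker s0 gamma1).
  have : 0 < (theta b z).1.
    by apply: theta_Re_gt0; have := Bgamma bB; rewrite /=; lra.
  lra.
have [ks es] := mu_sum (fun b => ker s (z + b)) kt.
rewrite /kmean -mu_inv// [LHS](_ : _ = \sum_(b <- B) ker s (z + b) *
  mu (fun beta => ker s (theta b z + beta)))// -es.
have kd := kdom_dualop s0 gamma1 Bgamma kz.
have eqd beta : gamma <= beta.1 -> dualop s B (fun beta => ker s (z + beta)) beta =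
    \sum_(b <- B) ker s (z + b) * ker s (theta b z + beta).
  by move=> hb; apply: (dualop_ker s gamma1 Bgamma) => //; lra.
(* The two functions are known to agree only at poles with Re >= gamma, so monotonicity in both
   directions replaces extensionality. *)
by apply/eqP; rewrite eq_le !mu_le// => beta /eqd ->.
Qed.

(** For every pole, p and q of z + beta lie in the disc, so the bounds hold kernel by kernel; the
    positive functional keeps them. *)
Lemma ktrans_between e lo hi z : 0 <= z.1 -> pq_between gamma e lo hi ->
  lo <= ktrans s mu e z / kmean s mu z <= hi.
Proof.
move=> z0 he; have g1 := gamma1.
have hz : - (1 / 2) <= z.1 by lra.
have hz' : - (3 / 4) <= z.1 by lra.
have v0 := kmean_gt0 s0 gamma1 mu_lin mu_le mu_ker hz.
have kk := kdom_ker s0 gamma1 hz'; have ke := kdom_kerpq s0 gamma1 e hz'.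
have pt beta : gamma <= beta.1 -> lo * ker s (z + beta) <= kerpq s e (z + beta) /\
    kerpq s e (z + beta) <= hi * ker s (z + beta).
  move=> hb; have hzb : gamma <= (z + beta).1 by rewrite /=; lra.
  have zb0 : 0 < (z + beta).1 by lra.
  have n0 : 0 < sqn (z + beta) by exact: sqnorm_gt0.
  have p0 : 0 <= (z + beta).1 / sqn (z + beta) by rewrite divr_ge0// ltW.
  have pq : gamma * (((z + beta).1 / sqn (z + beta)) ^+ 2 +
      ((z + beta).2 / sqn (z + beta)) ^+ 2) <= (z + beta).1 / sqn (z + beta).
    rewrite (_ : _ ^+ 2 + _ ^+ 2 = (sqn (z + beta))^-1).
      by rewrite ler_pM2r ?invr_gt0.
    by move: n0; rewrite /sqn => n0; field; rewrite gt_eqF.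
  have /andP[h1 h2] := he _ _ p0 pq.
  by rewrite /kerpq !ler_wpM2r ?ker_ge0.
rewrite ler_pdivlMr// ler_pdivrMr//.
rewrite /kmean -!(muZ mu_lin)//.
by apply/andP; split; apply: mu_le => //; try exact: (kdomZ _ kk); move=> beta /pt[].
Qed.

End KernelTransformEigen.

(** * Continuous extension to the closure *)

Section ClosureExtension.
Variable R : realType.
Implicit Types (z w b : R * R) (H : set (R * R)) (f g : R * R -> R).

Lemma near_closure_within H g z : closure H z ->
  {within closure H, continuous g} -> g w @[w --> within H (nbhs z)] --> g z.
Proof.
move=> Hz /subspace_continuousP/(_ z Hz) cg.
apply: cvg_trans cg; apply: cvg_app.
by apply: within_subset => w; exact: subset_closure.
Qed.

(** Both values are limits along H of the same function. Statements about all extensions thus reduce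
    to a single one. *)
Lemma cext_unique H f g1 g2 z : cext H g1 f -> cext H g2 f -> closure H z ->
  g1 z = g2 z.
Proof.
move=> [c1 e1] [c2 e2] Hz.
have PH : ProperFilter (within H (nbhs z)) by exact: within_nbhs_proper.
have l1 := near_closure_within Hz c1; have l2 := near_closure_within Hz c2.
apply: (cvg_unique (@norm_hausdorff R R) l1); apply: cvg_trans l2.
apply: near_eq_cvg; apply: filterS (withinT H _) => w Hw.
by rewrite e1// e2.
Qed.

Lemma closure_Re_ge0 H : (forall z, H z -> 0 < z.1) ->
  forall z, closure H z -> 0 <= z.1.
Proof.
move=> H0 z Hz; rewrite leNgt; apply/negP => z0.
have nz : \forall w \near z, w.1 < 0.
  by apply: (near_fst (P := fun t => t < 0)); exact: lt_nbhsl.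
have [w [Hw /=]] := Hz _ nz.
by rewrite ltNge ltW// H0.
Qed.

Lemma compact_closure_bounded H : bounded_set H -> compact (closure H).
Proof.
move=> [M' [_ hM']]; have [M hM] : exists M, forall z, H z -> `|z| <= M.
  by exists (M' + 1); apply: hM'; rewrite ltrDl.
have cbox := compact_setX (@segment_compact R (- M) M) (@segment_compact R (- M) M).
apply: (subclosed_compact _ cbox); first exact: closed_closure.
rewrite [X in _ `<=` X](closure_id _).1; last exact: compact_closed cbox.
apply: closure_subset => z Hz; have := hM z Hz; rewrite prod_normE ge_max.
by move=> /andP[h1 h2]; split=> /=; rewrite in_itv/= -ler_norml.
Qed.

(** [theta b] maps H into the disc, hence into H, and is continuous on the closure. *)
Lemma theta_closure gamma H b z : 1 <= gamma -> gamma <= b.1 ->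
  Ggamma gamma `<=` H -> (forall z, H z -> 0 < z.1) ->
  closure H z -> closure H (theta b z).
Proof.
move=> g1 bg GH H0 Hz A nA.
have z0 := closure_Re_ge0 H0 Hz.
have zb : 0 < (z + b).1 by rewrite /=; lra.
have [w [Hw Aw]] := Hz _ (theta_continuous zb nA).
by exists (theta b w); split=> //; apply/GH/theta_Ggamma => //; exact: H0.
Qed.

Lemma ker_continuous s b z : 0 < s -> 1 <= b.1 -> 0 <= z.1 ->
  {for z, continuous (fun w => ker s (w + b))}.
Proof.
move=> s0 b1 z0.
(* Evaluation at b is a functional to which the general result applies. *)
have := @ktrans_continuous R s 1 (fun phi => phi b) s0 (lexx 1) _ _ _
  (PQconst 1) z _.
rewrite -kmeanE; apply => //; first by move=> phi psi _ _; exact.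
  by apply: ker_gt0; lra.
lra.
Qed.

Lemma cvg_seq_sum (T : Type) (I : eqType) (F : set_system T) (r : seq I)
    (f : I -> T -> R) (l : I -> R) : Filter F ->
  (forall i, i \in r -> f i x @[x --> F] --> l i) ->
  \sum_(i <- r) f i x @[x --> F] --> \sum_(i <- r) l i.
Proof.
move=> FF; elim: r => [_|i r IH hf].
  rewrite big_nil [X in X @ _ --> _](_ : _ = fun=> 0); first exact: cvg_cst.
  by apply/funext => x; rewrite big_nil.
rewrite big_cons [X in X @ _ --> _](_ : _ = f i \+ fun x => \sum_(i <- r) f i x).
  apply: cvgD; first exact: hf (mem_head _ _).
  by apply: IH => j jr; apply: hf; rewrite in_cons jr orbT.
by apply/funext => x; rewrite big_cons.
Qed.

(** Both sides are limits along H of equal quantities. As [g] is continuous only within the closure,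
    the points [theta b w] have to be kept there. *)
Lemma Lambda_eigen_closure (s gamma lam : R) (B : seq (R * R)) H f g :
  0 < s -> 1 <= gamma -> (forall b, b \in B -> gamma <= b.1) ->
  Ggamma gamma `<=` H -> (forall z, H z -> 0 < z.1) ->
  cext H g f -> (forall z, H z -> Lambda s B f z = lam * f z) ->
  forall z, closure H z -> Lambda s B g z = lam * g z.
Proof.
move=> s0 g1 Bg GH H0 [cg eg] ef z Hz.
have PH : ProperFilter (within H (nbhs z)) by exact: within_nbhs_proper.
have z0 := closure_Re_ge0 H0 Hz.
have gz := near_closure_within Hz cg.
have Lg : Lambda s B g w @[w --> within H (nbhs z)] --> Lambda s B g z.
  apply: cvg_seq_sum => b bB; have bg := Bg b bB.
  have zb : 0 < (z + b).1 by rewrite /=; lra.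
  apply: cvgM.
    apply: cvg_within_filter; apply: (@ker_continuous s b z) => //.
    exact: le_trans bg.
  have Htz := theta_closure g1 bg GH H0 Hz.
  move/subspace_continuousP/(_ _ Htz) : cg => cgt.
  move=> A /cgt nA; have := theta_continuous zb nA.
  rewrite /fmap /within /nbhs /=; apply: filterS => w /= hw Hw; apply: hw.
  by apply: (theta_closure g1 bg GH H0); exact: subset_closure.
apply: (cvg_unique (@norm_hausdorff R R) Lg).
have l2 : lam * g w @[w --> within H (nbhs z)] --> lam * g z by exact: cvgMl_tmp.
apply: cvg_trans l2.
apply: near_eq_cvg; apply: filterS (withinT H _) => w Hw.
rewrite eg// -ef// /Lambda !big_seq; apply: eq_bigr => b bB.
by rewrite eg//; apply/GH/theta_Ggamma => //; [exact: Bg|exact: H0].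
Qed.

Lemma ratio_between_cext H v (ws : seq bool) g0 gw (lo hi : R) : cext H g0 v ->
  cext H gw (Dw ws v) -> (forall z, closure H z -> lo <= gw z / g0 z <= hi) ->
  ratio_between H v ws lo hi.
Proof.
move=> c0 cw h g0' gw' c0' cw' z Hz.
by rewrite (cext_unique c0' c0 Hz) (cext_unique cw' cw Hz) h.
Qed.

Lemma absratio_le_cext H v (ws : seq bool) g0 gw (lo hi c : R) : cext H g0 v ->
  cext H gw (Dw ws v) -> (forall z, closure H z -> 0 < g0 z) ->
  (forall z, closure H z -> lo <= gw z / g0 z <= hi) -> - c <= lo -> hi <= c ->
  absratio_le H v ws c.
Proof.
move=> c0 cw v0 h clo chi g0' gw' c0' cw' z Hz.
rewrite (cext_unique c0' c0 Hz) (cext_unique cw' cw Hz).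
rewrite -[g0 z]gtr0_norm ?v0// -normf_div ler_norml.
have /andP[h1 h2] := h z Hz.
by rewrite (le_trans clo h1) (le_trans h2 chi).
Qed.

End ClosureExtension.

(** * Existence, uniqueness and bounds combined *)

Theorem theorem7p10 (R : realType) (B : seq (R * R)) (gamma s : R)
    (H : set (R * R)) (m : nat) :
  uniq B -> B != [::] ->
  1 <= gamma -> (forall b, b \in B -> gamma <= b.1) ->
  0 < s ->
  open H -> bounded_set H -> mildly_regular H ->
  Ggamma gamma `<=` H -> (forall z, H z -> 0 < z.1) ->
  (0 < m)%N ->
  exists v : R * R -> R,
    [/\ Cm_bar m H v,
        (exists lam : R, forall z, H z -> Lambda s B v z = lam * v z),
        positive_on_closure H v,
        (forall u : R * R -> R, Cm_bar m H u ->
           (exists lam : R, forall z, H z -> Lambda s B u z = lam * u z) ->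
           positive_on_closure H u ->
           exists c : R, 0 < c /\ forall z, H z -> u z = c * v z) &
        [/\ (forall k : nat, Cm_bar k H v),
        [/\ ratio_between H v (nseq 1 true) (- (2 * s / gamma)) 0,
            ratio_between H v (nseq 2 true)
              (- (s / (4 * gamma ^+ 2 * (s + 1))))
              (2 * s * (2 * s + 1) / gamma ^+ 2),
            ratio_between H v (nseq 3 true)
              (- (2 * s * (2 * s + 1) * (2 * s + 2) / gamma ^+ 3))
              ((2 * s) * (2 * s + 2) / (gamma ^+ 3 * (s + 2) ^+ 2)) &
            ratio_between H v (nseq 4 true)
              (- (2 * s * (2 * s + 2) * (3 * s + 3) / gamma ^+ 4))
              ((2 * s) * (2 * s + 1) * (2 * s + 2) * (2 * s + 3) / gamma ^+ 4)],
        [/\ absratio_le H v (nseq 1 false) (s / gamma),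
            ratio_between H v (nseq 2 false)
              (- (2 * s / gamma ^+ 2))
              (2 * s * (2 * s + 1) / (4 * gamma ^+ 2)),
            absratio_le H v (nseq 3 false)
              ((2 * s) * (2 * s + 2) / gamma ^+ 3 *
                 Num.max (25 * Num.sqrt 5 / 72) ((2 * s + 1) / 8)) &
            ratio_between H v (nseq 4 false)
              (- (2 * s * (2 * s + 2) * (3 * s + 3) / gamma ^+ 4))
              ((2 * s) * (2 * s + 1) * (2 * s + 2) * (2 * s + 3) / gamma ^+ 4)] &
        (forall (k : bool) (j : nat), (1 <= j <= 4)%N ->
           absratio_le H v (nseq j k)
             ((\prod_(i < j) (2 * s + i%:R)) / gamma ^+ j))]].

Proof.
move=> _ B0 gamma1 Bgamma s0 openH bndH _ GH H0 _.
have [rho [mu [rho0 mu_lin mu_le mu_inv mu_ker]]] :=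
  dual_eigenfunctional s0 gamma1 B0 Bgamma.
pose v := kmean s mu.
(* [V ws] will be the continuous extension of [Dw ws v] to the closure. *)
pose V ws := ktrans s mu (pqword s ws (PQconst 1)).
have closure_re := closure_Re_ge0 H0.
have V0 : v = V [::] by exact: kmeanE.
have VE ws z : 0 <= z.1 -> Dw ws v z = V ws z.
  by move=> z0; rewrite /v kmeanE (Dw_ktrans s0 gamma1 mu_lin mu_le)//; lra.
have Vext ws : cext H (V ws) (Dw ws v).
  split; last by move=> z /H0 z0; rewrite VE// ltW.
  apply: continuous_in_subspaceT => z /set_mem /closure_re z0.
  by apply: (ktrans_continuous s0 gamma1 mu_lin mu_le mu_ker); lra.
have vext : cext H v v by rewrite {1}V0; exact: (Vext [::]).
have v_gt0 z : closure H z -> 0 < v z.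
  move=> /closure_re z0.
  by apply: (kmean_gt0 s0 gamma1 mu_lin mu_le mu_ker); lra.
have vC k : Cm_bar k H v.
  split; last by move=> ws _; exists (V ws).
  move=> ws _ z /H0 z0 d; rewrite /v kmeanE.
  by apply: (derivable_Dw_ktrans s0 gamma1 mu_lin mu_le); lra.
have vL z : closure H z -> Lambda s B v z = rho * v z.
  by move=> /closure_re z0; apply: (Lambda_kmean s0 gamma1 Bgamma mu_lin mu_le).
have Vbetween k j lo hi : pq_between gamma (pqseq s k j) lo hi ->
    forall z, closure H z -> lo <= V (nseq j k) z / v z <= hi.
  move=> hb z /closure_re z0.
  exact: (ktrans_between s0 gamma1 mu_lin mu_le mu_ker z0 hb).
have ratio k j lo hi : pq_between gamma (pqseq s k j) lo hi ->
    ratio_between H v (nseq j k) lo hi.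
  by move=> /Vbetween hb; exact: ratio_between_cext vext (Vext _) hb.
have absratio k j lo hi c : pq_between gamma (pqseq s k j) lo hi ->
    - c <= lo -> hi <= c -> absratio_le H v (nseq j k) c.
  by move=> /Vbetween hb; exact: absratio_le_cext vext (Vext _) v_gt0 hb.
exists v; split.
- exact: vC.
- by exists rho => z Hz; apply: vL; exact: subset_closure.
- by move=> g cg z Hz; rewrite (cext_unique cg vext Hz) v_gt0.
- move=> u [_ Cu] [lam eu] pu; have [g cg] := Cu [::] isT.
  (* The centre of the disc witnesses that H is nonempty. *)
  have G0 : H ((2 * gamma)^-1, 0).
    apply: GH; rewrite /Ggamma /= subrr /enorm expr0n /= addr0 sqrtr0.
    by rewrite invr_gt0; lra.
  have Kth b z : b \in B -> closure H z -> closure H (theta b z).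
    by move=> bB; apply: theta_closure GH H0 => //; exact: Bgamma.
  have K0 : closure H !=set0.
    by exists ((2 * gamma)^-1, 0); exact: subset_closure.
  have eg := Lambda_eigen_closure s0 gamma1 Bgamma GH H0 cg eu.
  have [c [c0 hc]] := eigenfunction_unique gamma1 B0 Bgamma
    (compact_closure_bounded bndH) K0 closure_re Kth cg.1 vext.1 (pu _ cg) v_gt0 eg vL.
  exists c; split=> // z Hz; rewrite -hc; last exact: subset_closure.
  by rewrite cg.2.
split.
- exact: vC.
- split.
  + exact/ratio/between_x1.
  + exact/ratio/between_x2.
  + exact/ratio/between_x3.
  + exact/ratio/between_x4.
- split.
  + by apply: absratio (between_y1 s0 gamma1) _ _.
  + exact/ratio/between_y2.
  + by apply: absratio (between_y3 s0 gamma1) _ _.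
  + exact/ratio/between_y4.
move=> k j /(between_rising s0 gamma1 k)[lo [hi [hb clo chi]]].
exact: absratio hb clo chi.
Qed.
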